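(* Let $(\mathcal A,\varphi)$ be a non-commutative probability space ($\mathcal A$ a unital associative $k$-algebra, $\varphi:\mathcal A\to k$ linear and unital), $\Phi$ the associated character on $\overline H=\overline T(T(\mathcal A))$, and $\mathbb B(\Phi):=\mathcal E_\prec(\log^\succ(\Phi))$. For any sequence $\mathbf a=(a_1,\dots,a_n)$ of elements of $\mathcal A$ with moment functional $\mu$, one has $$\log^\prec(\mathbb B(\Phi))(\mathbf a)=\log^\succ(\Phi)(\mathbf a),$$ meaning that $\log^\prec(\mathbb B(\Phi))(a_{i_1}\cdots a_{i_m})=\log^\succ(\Phi)(a_{i_1}\cdots a_{i_m})$ for all $m\ge1$ and $i_1,\dots,i_m\in\{1,\dots,n\}$, and therefore $$R_{\mathbb B(\mu)}=R^{\mathbb B(\Phi)}_{\mathbf a}=\eta_{\mathbf a}=\eta_\mu .$$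
   Context: $k$ is a field of characteristic zero. Double tensor algebra. $T(\mathcal A)=\bigoplus_{n>0}\mathcal A^{\otimes n}$, elements written as words $a_1\cdots a_n$ ($=a_1\otimes\cdots\otimes a_n$); products in $\mathcal A$ are written $\cdot_{\mathcal A}$. $\overline H=\overline T(T(\mathcal A))=\bigoplus_{n\ge0}T(\mathcal A)^{\otimes n}=k\mathbf 1\oplus H$ with concatenation product $w_1|\cdots|w_m$. For $S=\{s_1<\dots<s_p\}\subseteq[n]$, $a_S:=a_{s_1}\cdots a_{s_p}$ ($a_\emptyset=\mathbf 1$); if $J_1,\dots,J_l$ (in increasing order) are the maximal intervals of consecutive integers in $[n]\setminus S$, $a_{J^S_{[n]}}:=a_{J_1}|\cdots|a_{J_l}$. Coproduct: $\Delta(a_1\cdots a_n)=\sum_{S\subseteq[n]}a_S\otimes a_{J^S_{[n]}}$, extended multiplicatively. $\Delta^+_\prec(a_1\cdots a_n):=\sum_{1\in S}a_S\otimes a_{J^S_{[n]}}$, $\Delta^+_\succ(a_1\cdots a_n):=\sum_{1\notin S}a_S\otimes a_{J^S_{[n]}}$, extended by $\Delta^+_{\prec}(w_1|\cdots|w_m)=\Delta^+_\prec(w_1)\Delta(w_2)\cdots\Delta(w_m)$ (likewise $\Delta^+_\succ$); $\Delta_\prec(x)=\Delta^+_\prec(x)-x\otimes\mathbf 1$, $\Delta_\succ(x)=\Delta^+_\succ(x)-\mathbf 1\otimes x$ on $H$. $e$ is the augmentation; $f*g=m_k(f\otimes g)\Delta$ for linear forms on $\overline H$; for linear forms vanishing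 on $\mathbf 1$, $f\prec g=m_k(f\otimes g)\Delta_\prec$, $f\succ g=m_k(f\otimes g)\Delta_\succ$, extended by $e\succ f=f=f\prec e$, $e\prec f=0=f\succ e$. $G_H(k)$: characters (unital algebra maps $\overline H\to k$); $g_H(k)$: linear forms $\gamma$ with $\gamma(\mathbf 1)=0$, $\gamma(x|y)=0$ for $x,y\in H$. $\mathcal E_\prec(\alpha)$, for $\alpha\in g_H(k)$, is the unique solution of $\Phi=e+\alpha\prec\Phi$ and lies in $G_H(k)$; $\log^\prec(\Phi)=(\Phi-e)\prec\Phi^{-1}$ is the inverse bijection $G_H(k)\to g_H(k)$; $\log^\succ(\Phi)=\Phi^{-1}\succ(\Phi-e)\in g_H(k)$ (inverses for $*$). Character of $(\mathcal A,\varphi)$: $\varphi(a_1\cdots a_n):=\varphi(a_1\cdot_{\mathcal A}\cdots\cdot_{\mathcal A}a_n)$ on $T(\mathcal A)$, $\Phi(w_1|\cdots|w_m):=\varphi(w_1)\cdots\varphi(w_m)$. The moment functional of $\mathbf a$ is the unital linear form $\mu$ on $k\langle X_1,\dots,X_n\rangle$, $\mu(P)=\varphi(P(a_1,\dots,a_n))$. For a character $\Psi\in G_H(k)$, put $R^{\Psi}_{\mathbf a}:=\sum_{w}\log^\prec(\Psi)(\mathbf a_w)\,w$ and $\eta^\Psi_{\mathbf a}:=\sum_w\log^\succ(\Psi)(\mathbf a_w)\,w$, sums over nonempty words $w=X_{i_1}\cdots X_{i_m}$, where $\mathbf a_w=a_{i_1}\cdots a_{i_m}\in\mathcal A^{\otimes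 m}\subset T(\mathcal A)$; $R_{\mathbf a}:=R_{\mathbf a}^\Phi$, $\eta_{\mathbf a}:=\eta^\Phi_{\mathbf a}$. For an arbitrary unital linear form $\nu$ on $k\langle X_1,\dots,X_n\rangle$, $R_\nu$ and $\eta_\nu$ denote these series for the sequence $(X_1,\dots,X_n)$ in the non-commutative probability space $(k\langle X_1,\dots,X_n\rangle,\nu)$. The Bercovici--Pata bijection on such forms is defined by the relation $R_{\mathbb B(\nu)}=\eta_\nu$. *)

(* Defs.v *)
From HB Require Import structures.
From mathcomp Require Import all_boot all_order all_algebra.
From mathcomp Require Import finmap boolp.
From mathcomp.multinomials Require Import monalg.

Set Implicit Arguments.
Unset Strict Implicit.
Unset Printing Implicit Defensive.

Import GRing.Theory.
Local Open Scope ring_scope.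
Local Open Scope quotient_scope.

(* The x such that P x, when there is one: used to name an object that is    *)
(* characterized by an equation, with a junk value x0 otherwise.             *)
Definition pick_or (T : Type) (x0 : T) (P : T -> Prop) : T :=
  if pselect (exists x, P x) is left ex then projT1 (cid ex) else x0.

(* Modules presented by generators w : W and relations w0 = c w1 + w2:       *)
(* the free module on W modulo the span of the relators. Every tensor        *)
(* construction below is of this form.                                       *)
Section Presented.
Variables (k : fieldType) (W : choiceType) (Rel : k -> W -> W -> W -> Prop).

Definition respects (M : lmodType k) (f : W -> M) : Prop :=
  forall c w0 w1 w2, Rel c w0 w1 w2 -> f w0 = c *: f w1 + f w2.

Definition relator (r : {malg k[W]}) : Prop :=
  exists c w0 w1 w2,
    Rel c w0 w1 w2 /\ r = << w0 >> - c *: << w1 >> - << w2 >>.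

Inductive relator_span : {malg k[W]} -> Prop :=
| RelatorSpan0 : relator_span 0
| RelatorSpanD c r x :
    relator r -> relator_span x -> relator_span (c *: r + x).

Lemma relator_spanD x y :
  relator_span x -> relator_span y -> relator_span (x + y).
Proof.
move=> sx sy; elim: sx => [|c r z rr _ IH]; first by rewrite add0r.
by rewrite -addrA; apply: RelatorSpanD.
Qed.

Lemma relator_spanZ c x : relator_span x -> relator_span (c *: x).
Proof.
move=> sx; elim: sx => [|d r z rr _ IH]; first by rewrite scaler0; constructor.
by rewrite scalerDr scalerA; apply: RelatorSpanD.
Qed.

Definition relator_pred : {pred {malg k[W]}} := fun x => `[< relator_span x >].

Lemma relator_pred_closed : zmod_closed relator_pred.
Proof.
split=> [|x y]; first by apply/asboolP; constructor.
move=> /asboolP sx /asboolP sy; apply/asboolP; apply: relator_spanD => //.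
by rewrite -scaleN1r; apply: relator_spanZ.
Qed.

HB.instance Definition _ :=
  GRing.isZmodClosed.Build {malg k[W]} relator_pred relator_pred_closed.

Definition presq : Type := Quotient.quot relator_pred.

HB.instance Definition _ := GRing.Zmodule.on presq.
HB.instance Definition _ := EqQuotient.on presq.

Lemma presq_eqP (x y : {malg k[W]}) :
  (\pi_presq x = \pi_presq y) <-> relator_span (x - y).
Proof.
have E := @Quotient.idealrBE _ relator_pred x y.
split=> [/eqP|h]; first by rewrite -E => /asboolP.
by apply/eqP; rewrite -E; apply/asboolP.
Qed.

Lemma presq_piP (P : presq -> Prop) : (forall x, P (\pi_presq x)) -> forall x, P x.
Proof. by move=> Px x; rewrite -[x]reprK. Qed.

Lemma presq_piD (x y : {malg k[W]}) : \pi_presq (x + y) = \pi_presq x + \pi_presq y.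
Proof. exact: (@pi_addr _ _ _ _ _ (Quotient.quot relator_pred)). Qed.

Definition presq_scale (c : k) (x : presq) : presq := \pi_presq (c *: repr x).

Lemma presq_piZ c (x : {malg k[W]}) : \pi_presq (c *: x) = presq_scale c (\pi_presq x).
Proof.
apply/presq_eqP; rewrite -scalerBr; apply: relator_spanZ.
by apply/presq_eqP; rewrite reprK.
Qed.

Lemma presq_scaleA a b v : presq_scale a (presq_scale b v) = presq_scale (a * b) v.
Proof. by elim/presq_piP: v => x; rewrite -!presq_piZ scalerA. Qed.
Lemma presq_scale1 : left_id 1 presq_scale.
Proof. by elim/presq_piP=> x; rewrite -!presq_piZ scale1r. Qed.
Lemma presq_scaleDr : right_distributive presq_scale +%R.
Proof.
move=> c; elim/presq_piP=> x; elim/presq_piP=> y.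
by rewrite -presq_piD -!presq_piZ scalerDr presq_piD.
Qed.
Lemma presq_scaleDl v : {morph presq_scale^~ v : a b / a + b}.
Proof.
move=> a b; elim/presq_piP: v => x.
by rewrite -!presq_piZ scalerDl presq_piD.
Qed.

HB.instance Definition _ := GRing.Zmodule_isLmodule.Build k presq
  presq_scaleA presq_scale1 presq_scaleDr presq_scaleDl.

Definition qgen (w : W) : presq := \pi_presq << w >>.

Lemma qgen_rel c w0 w1 w2 :
  Rel c w0 w1 w2 -> qgen w0 = c *: qgen w1 + qgen w2.
Proof.
move=> h; rewrite /qgen /GRing.scale /= -presq_piZ -presq_piD; apply/presq_eqP.
rewrite -[_ - _]addr0 -[_ - _]scale1r; apply: RelatorSpanD; last by constructor.
by exists c, w0, w1, w2; split=> //; rewrite opprD addrA.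
Qed.

Lemma presq_ind (P : presq -> Prop) :
  P 0 -> (forall c w x, P x -> P (c *: qgen w + x)) -> forall x, P x.
Proof.
move=> P0 PD; elim/presq_piP=> x; rewrite [x]monalgE.
elim: (enum_fset _) => [|w s IH].
  by rewrite big_nil (_ : \pi 0 = 0) //; exact: (@pi_zeror _ _ _ _ _ (Quotient.quot relator_pred)).
rewrite big_cons presq_piD.
have -> : << x@_w *g w >> = x@_w *: << w >> :> {malg k[W]}.
  by apply/malgP=> v; rewrite mcoeffZ !mcoeffU mulrnAr mulr1.
by rewrite presq_piZ; apply: PD.
Qed.

Section Lift.
Variable M : lmodType k.
Implicit Type f : W -> M.

Definition free_ext f (x : {malg k[W]}) : M := \sum_(w <- msupp x) x@_w *: f w.

Lemma free_extEw f x (d : {fset W}) : fsubset (msupp x) d ->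
  free_ext f x = \sum_(w <- d) x@_w *: f w.
Proof.
move=> le; rewrite /free_ext (big_fset_incl _ le) // => w _ /mcoeff_outdom ->.
by rewrite scale0r.
Qed.

Lemma free_ext_linear f : linear (free_ext f).
Proof.
move=> c x y; pose d := fsetU (msupp (c *: x + y)) (fsetU (msupp x) (msupp y)).
have sub0 : fsubset (msupp (c *: x + y)) d by exact: fsubsetUl.
have sub1 : fsubset (msupp x) d.
  by rewrite /d fsubsetU // fsubsetUl orbT.
have sub2 : fsubset (msupp y) d.
  by rewrite /d fsubsetU // fsubsetUr orbT.
rewrite (free_extEw f sub0) (free_extEw f sub1) (free_extEw f sub2).
rewrite scaler_sumr -big_split /=; apply: eq_bigr => w _.
by rewrite mcoeffD mcoeffZ scalerDl scalerA.
Qed.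

HB.instance Definition _ f :=
  GRing.isLinear.Build k {malg k[W]} M _ (free_ext f) (free_ext_linear f).

Lemma free_extU f w : free_ext f << w >> = f w.
Proof.
by rewrite (free_extEw f msuppU_le) big_seq_fset1 mcoeffUU scale1r.
Qed.

Definition presq_ext f (x : presq) : M := free_ext f (repr x).

Lemma presq_ext_pi f x : respects f -> presq_ext f (\pi_presq x) = free_ext f x.
Proof.
move=> rf; apply/eqP; rewrite -subr_eq0 -linearB; apply/eqP.
have : relator_span (repr (\pi_presq x) - x) by apply/presq_eqP; rewrite reprK.
elim=> [|c r y rr _ IH]; first by rewrite linear0.
rewrite linearP /= IH addr0; case: rr => [d [w0 [w1 [w2 [/rf h ->]]]]].
have -> : free_ext f (<< w0 >> - d *: << w1 >> - << w2 >>)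
          = f w0 - d *: f w1 - f w2.
  by rewrite linearB linearB linearZ /= !free_extU.
by rewrite h -addrA -opprD subrr scaler0.
Qed.

Lemma presq_ext_gen f w : respects f -> presq_ext f (qgen w) = f w.
Proof. by move=> rf; rewrite presq_ext_pi // free_extU. Qed.

Lemma presq_ext_linear f : respects f -> linear (presq_ext f).
Proof.
move=> rf c; elim/presq_piP=> x; elim/presq_piP=> y.
rewrite [c *: _](esym (presq_piZ c x)) -presq_piD !presq_ext_pi //.
by rewrite linearP.
Qed.

Definition presq_lift f (rf : respects f) := presq_ext f.

HB.instance Definition _ f (rf : respects f) :=
  GRing.isLinear.Build k presq M _ (presq_lift rf) (presq_ext_linear rf).

End Lift.

Record presentation : Type := Presentation {
  pres_mod : lmodType k;
  pres_gen : W -> pres_mod;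
  pres_gen_rel : respects pres_gen;
  pres_gen_ind : forall Q : pres_mod -> Prop,
    Q 0 -> (forall c w x, Q x -> Q (c *: pres_gen w + x)) -> forall x, Q x;
  pres_univ : forall (M : lmodType k) (f : W -> M), respects f ->
    {h : {linear pres_mod -> M} | forall w, h (pres_gen w) = f w} }.

(* Sealed on purpose: only the universal property is used, and unification   *)
(* must not unfold the quotient.                                             *)
Lemma presentation_exists : presentation.
Proof.
exists presq qgen; first exact: qgen_rel.
- exact: presq_ind.
- by move=> M f rf; exists (presq_lift rf) => w; exact: presq_ext_gen.
Qed.

Definition pres : lmodType k := pres_mod presentation_exists.
Definition pgen : W -> pres := pres_gen presentation_exists.

Lemma pgen_rel : respects pgen.
Proof. exact: pres_gen_rel. Qed.

Lemma pres_ind (Q : pres -> Prop) :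
  Q 0 -> (forall c w x, Q x -> Q (c *: pgen w + x)) -> forall x, Q x.
Proof. exact: pres_gen_ind. Qed.

Lemma pres_lin_ext (M : lmodType k) (f g : pres -> M) :
  linear f -> linear g -> (forall w, f (pgen w) = g (pgen w)) -> f =1 g.
Proof.
move=> lf lg fg; elim/pres_ind=> [|c w x IH]; last by rewrite lf lg fg IH.
have z h : linear h -> h (0 : pres) = 0 :> M.
  by move=> lh; have := lh (-1) 0 0; rewrite scaler0 addr0 scaleN1r addNr.
by rewrite (z f lf) (z g lg).
Qed.

Definition plift (M : lmodType k) (f : W -> M) (rf : respects f) :
  {linear pres -> M} := sval (pres_univ presentation_exists rf).

Lemma plift_gen (M : lmodType k) (f : W -> M) (rf : respects f) w :
  plift rf (pgen w) = f w.
Proof. exact: (svalP (pres_univ presentation_exists rf)). Qed.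

End Presented.

Arguments pgen {k W Rel} w.

Section BilinearLift.
Variables (k : fieldType) (W1 W2 : choiceType).
Variables (R1 : k -> W1 -> W1 -> W1 -> Prop) (R2 : k -> W2 -> W2 -> W2 -> Prop).
Variable M : lmodType k.
Variable f : W1 -> W2 -> M.
Hypothesis fl : forall w2, respects R1 (f^~ w2).
Hypothesis fr : forall w1, respects R2 (f w1).

Lemma plift2_respects y : respects R1 (fun w1 => plift (fr w1) y).
Proof.
move=> c w0 w1 w2 h; move: y; apply: pres_lin_ext.
- exact: linearP.
- have L w : linear (plift (fr w)) by exact: linearP.
  by move=> d x y; rewrite !L !scalerDr !scalerA mulrC addrACA.
- by move=> w; rewrite !plift_gen; apply: fl.
Qed.

Definition plift2 (x : pres R1) (y : pres R2) : M := plift (plift2_respects y) x.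

Lemma plift2_linl y : linear (plift2^~ y).
Proof. exact: linearP. Qed.

Lemma plift2_linr x : linear (plift2 x).
Proof.
move=> c y z; move: x; apply: pres_lin_ext.
- exact: plift2_linl.
- by move=> d u v; rewrite !plift2_linl !scalerDr !scalerA mulrC addrACA.
- by move=> w; rewrite /plift2 !plift_gen linearP.
Qed.

Lemma plift2_gen w1 w2 : plift2 (pgen w1) (pgen w2) = f w1 w2.
Proof. by rewrite /plift2 !plift_gen. Qed.

End BilinearLift.

(* Tensor powers: multilinear relations between words [wd w]. *)
Definition multilin_rel (k : fieldType) (V : lmodType k) (W : Type)
    (wd : W -> seq V) (c : k) (w0 w1 w2 : W) : Prop :=
  exists u v x y,
    [/\ wd w0 = u ++ (c *: x + y) :: v, wd w1 = u ++ x :: v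
      & wd w2 = u ++ y :: v].

(* The reduced tensor module, the sum of the V^(⊗ n) for n > 0. Its          *)
(* generators are the nonempty words, the word a s_1 ... s_m being encoded   *)
(* as the pair (a, s).                                                       *)
Definition neword (V : Type) : Type := (V * seq V)%type.
Definition letters (V : Type) (w : neword V) : seq V := w.1 :: w.2.

Section Tplus.
Variables (k : fieldType) (V : lmodType k).
HB.instance Definition _ := Choice.on (neword V).
Definition Tplus : Type := pres (@multilin_rel k V (neword V) (@letters V)).
HB.instance Definition _ := GRing.Lmodule.on Tplus.
Definition tword (w : neword V) : Tplus := pgen w.
End Tplus.

(* The unital tensor algebra, with the concatenation product. *)
Section Tbar.
Variables (k : fieldType) (V : lmodType k).
Definition Tbar : Type := pres (@multilin_rel k V (seq V) id).
HB.instance Definition _ := GRing.Lmodule.on Tbar.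

Definition bar (s : seq V) : Tbar := pgen s.

Definition Tbar_one : Tbar := bar [::].
Lemma bar_catl t : respects (@multilin_rel k V _ id) (fun s => bar (s ++ t)).
Proof.
move=> c _ _ _ [u [v [x [y [/= -> -> ->]]]]].
by apply: pgen_rel; exists u, (v ++ t), x, y; rewrite /= -!catA.
Qed.

Lemma bar_catr s : respects (@multilin_rel k V _ id) (fun t => bar (s ++ t)).
Proof.
move=> c _ _ _ [u [v [x [y [/= -> -> ->]]]]].
by apply: pgen_rel; exists (s ++ u), v, x, y; rewrite /= !catA.
Qed.

Definition Tbar_mul : Tbar -> Tbar -> Tbar := plift2 bar_catl bar_catr.

Let mul_linl y : linear (Tbar_mul^~ y).
Proof. exact: plift2_linl. Qed.
Let mul_linr x : linear (Tbar_mul x).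
Proof. exact: plift2_linr. Qed.

Lemma Tbar_mul_bar s t : Tbar_mul (bar s) (bar t) = bar (s ++ t).
Proof.
exact: plift2_gen.
Qed.

Lemma Tbar_mulA : associative Tbar_mul.
Proof.
move=> x y z; move: x; apply: pres_lin_ext.
- exact: mul_linl.
- by move=> c u v; rewrite !mul_linl.
move=> w1; move: y; apply: pres_lin_ext.
- by move=> c u v; rewrite mul_linl mul_linr.
- by move=> c u v; rewrite mul_linr mul_linl.
move=> w2; move: z; apply: pres_lin_ext.
- by move=> c u v; rewrite !mul_linr.
- exact: mul_linr.
by move=> w3; rewrite !Tbar_mul_bar catA.
Qed.

Lemma Tbar_mul1l : left_id Tbar_one Tbar_mul.
Proof.
apply: pres_lin_ext; first exact: mul_linr.
- by [].
- by move=> w; exact: Tbar_mul_bar.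
Qed.

Lemma Tbar_mul1r : right_id Tbar_one Tbar_mul.
Proof.
apply: pres_lin_ext; first exact: mul_linl.
- by [].
- by move=> w; rewrite Tbar_mul_bar cats0.
Qed.

Lemma Tbar_mulDl : left_distributive Tbar_mul +%R.
Proof. by move=> x y z; have := mul_linl z 1 x y; rewrite !scale1r. Qed.

Lemma Tbar_mulDr : right_distributive Tbar_mul +%R.
Proof. by move=> x y z; have := mul_linr x 1 y z; rewrite !scale1r. Qed.

Definition counit_word (s : seq V) : k^o := (nilp s)%:R.

Lemma counit_respects : respects (@multilin_rel k V _ id) counit_word.
Proof.
move=> c _ _ _ [u [v [x [y [/= -> -> ->]]]]].
by rewrite /counit_word; case: u => *; rewrite /= scaler0 addr0.
Qed.

Definition counit : {linear Tbar -> k^o} := plift counit_respects.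

Lemma counit_bar s : counit (bar s) = (nilp s)%:R.
Proof. exact: plift_gen. Qed.

Lemma Tbar_one_neq0 : Tbar_one != 0.
Proof.
apply/eqP=> /(congr1 counit); rewrite linear0 counit_bar => /eqP.
by rewrite oner_eq0.
Qed.

HB.instance Definition _ := GRing.Zmodule_isNzRing.Build Tbar
  Tbar_mulA Tbar_mul1l Tbar_mul1r Tbar_mulDl Tbar_mulDr Tbar_one_neq0.

Lemma Tbar_scaleAl (c : k) (x y : Tbar) : c *: (x * y) = c *: x * y.
Proof.
have z : Tbar_mul 0 y = 0 := mul0r (y : Tbar).
have := mul_linl y c x 0; rewrite addr0 z addr0 => h; exact: esym h.
Qed.

HB.instance Definition _ := GRing.Lmodule_isLalgebra.Build k Tbar Tbar_scaleAl.

Lemma Tbar_scaleAr (c : k) (x y : Tbar) : c *: (x * y) = x * (c *: y).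
Proof.
have z : Tbar_mul x 0 = 0 := mulr0 (x : Tbar).
have := mul_linr x c y 0; rewrite addr0 z addr0 => h; exact: esym h.
Qed.

HB.instance Definition _ := GRing.Lalgebra_isAlgebra.Build k Tbar Tbar_scaleAr.

Lemma bar_cat s t : bar (s ++ t) = bar s * bar t.
Proof. by rewrite -Tbar_mul_bar. Qed.

End Tbar.

Arguments counit {k V}.

Section Tensor2.
Variables (k : fieldType) (M N : lmodType k).

Definition bilin_rel (c : k) (p0 p1 p2 : M * N) : Prop :=
  (exists x1 x2 y, [/\ p0 = (c *: x1 + x2, y), p1 = (x1, y) & p2 = (x2, y)])
  \/
  (exists x y1 y2, [/\ p0 = (x, c *: y1 + y2), p1 = (x, y1) & p2 = (x, y2)]).

Definition tensor2 : Type := pres bilin_rel.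
HB.instance Definition _ := GRing.Lmodule.on tensor2.

Definition tens (x : M) (y : N) : tensor2 := pgen (x, y).

Lemma tens_linl y : linear (tens^~ y).
Proof. by move=> c x1 x2; apply: pgen_rel; left; exists x1, x2, y. Qed.
Lemma tens_linr x : linear (tens x).
Proof. by move=> c y1 y2; apply: pgen_rel; right; exists x, y1, y2. Qed.

(* [tensor_form f g] is m_k (f ⊗ g). *)
Definition pair_form (f : {linear M -> k^o}) (g : {linear N -> k^o}) (p : M * N) : k^o :=
  f p.1 * g p.2.

Lemma pair_form_respects f g : respects bilin_rel (pair_form f g).
Proof.
move=> c _ _ _ [[x1 [x2 [y [-> -> ->]]]]|[x [y1 [y2 [-> -> ->]]]]];
  rewrite /pair_form /= linearP /=.
- by rewrite mulrDl -scalerAl.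
- by rewrite mulrDr -scalerAr.
Qed.

Definition tensor_form f g : {linear tensor2 -> k^o} := plift (pair_form_respects f g).

Lemma tensor_form_tens f g x y : tensor_form f g (tens x y) = f x * g y.
Proof. exact: plift_gen. Qed.

End Tensor2.

Section TensorAlgebra.
Variables (k : fieldType) (V : lmodType k).
Local Notation H := (Tbar V).

Definition Tbar2 : Type := tensor2 H H.
HB.instance Definition _ := GRing.Lmodule.on Tbar2.

Definition Tbar2_one : Tbar2 := tens 1 1.
Lemma tens_mul_respl (q : H * H) : respects (@bilin_rel k H H)
  (fun p : H * H => (tens (p.1 * q.1) (p.2 * q.2) : Tbar2)).
Proof.
move=> c _ _ _ [[x1 [x2 [y [-> -> ->]]]]|[x [y1 [y2 [-> -> ->]]]]] /=;
  rewrite mulrDl -scalerAl.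
- exact: tens_linl.
- exact: tens_linr.
Qed.

Lemma tens_mul_respr (p : H * H) : respects (@bilin_rel k H H)
  (fun q : H * H => (tens (p.1 * q.1) (p.2 * q.2) : Tbar2)).
Proof.
move=> c _ _ _ [[x1 [x2 [y [-> -> ->]]]]|[x [y1 [y2 [-> -> ->]]]]] /=;
  rewrite mulrDr -scalerAr.
- exact: tens_linl.
- exact: tens_linr.
Qed.

Definition Tbar2_mul : Tbar2 -> Tbar2 -> Tbar2 :=
  plift2 tens_mul_respl tens_mul_respr.

Let mul_linl y : linear (Tbar2_mul^~ y).
Proof. exact: plift2_linl. Qed.
Let mul_linr x : linear (Tbar2_mul x).
Proof. exact: plift2_linr. Qed.

Lemma Tbar2_mul_tens x y x' y' :
  Tbar2_mul (tens x y) (tens x' y') = tens (x * x') (y * y').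
Proof.
exact: plift2_gen.
Qed.

Lemma Tbar2_ext (M : lmodType k) (f g : Tbar2 -> M) :
  linear f -> linear g -> (forall x y, f (tens x y) = g (tens x y)) -> f =1 g.
Proof. by move=> lf lg fg; apply: (pres_lin_ext lf lg) => -[x y]; apply: fg. Qed.

Lemma Tbar2_mulA : associative Tbar2_mul.
Proof.
move=> x y z.
apply: (@Tbar2_ext _ (Tbar2_mul^~ (Tbar2_mul y z))
                     (fun x => Tbar2_mul (Tbar2_mul x y) z)) x.
- exact: (mul_linl (Tbar2_mul y z)).
- by move=> c u v; rewrite !mul_linl.
move=> x1 y1.
apply: (@Tbar2_ext _ (fun y => Tbar2_mul (tens x1 y1) (Tbar2_mul y z))
                     (fun y => Tbar2_mul (Tbar2_mul (tens x1 y1) y) z)) y.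
- by move=> c u v; rewrite mul_linl mul_linr.
- by move=> c u v; rewrite mul_linr mul_linl.
move=> x2 y2.
apply: (@Tbar2_ext _ (fun z => Tbar2_mul (tens x1 y1) (Tbar2_mul (tens x2 y2) z))
                     (Tbar2_mul (Tbar2_mul (tens x1 y1) (tens x2 y2)))) z.
- by move=> c u v; rewrite (mul_linr _ c u v) (mul_linr _ c).
- exact: (mul_linr (Tbar2_mul (tens x1 y1) (tens x2 y2))).
by move=> x3 y3; rewrite !Tbar2_mul_tens !mulrA.
Qed.

Lemma Tbar2_mul1l : left_id Tbar2_one Tbar2_mul.
Proof.
apply: (@Tbar2_ext _ (Tbar2_mul Tbar2_one) id); [exact: (mul_linr Tbar2_one)| by [] |].
by move=> x y; rewrite Tbar2_mul_tens !mul1r.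
Qed.

Lemma Tbar2_mul1r : right_id Tbar2_one Tbar2_mul.
Proof.
apply: (@Tbar2_ext _ (Tbar2_mul^~ Tbar2_one) id); [exact: (mul_linl Tbar2_one)| by [] |].
by move=> x y; rewrite Tbar2_mul_tens !mulr1.
Qed.

Lemma Tbar2_mulDl : left_distributive Tbar2_mul +%R.
Proof. by move=> x y z; have := mul_linl z 1 x y; rewrite !scale1r. Qed.

Lemma Tbar2_mulDr : right_distributive Tbar2_mul +%R.
Proof. by move=> x y z; have := mul_linr x 1 y z; rewrite !scale1r. Qed.

Lemma Tbar2_one_neq0 : Tbar2_one != 0.
Proof.
apply/eqP=> /(congr1 (tensor_form counit counit)).
rewrite linear0 tensor_form_tens !counit_bar => /eqP.
by rewrite mulr1 oner_eq0.
Qed.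

HB.instance Definition _ := GRing.Zmodule_isNzRing.Build Tbar2
  Tbar2_mulA Tbar2_mul1l Tbar2_mul1r Tbar2_mulDl Tbar2_mulDr Tbar2_one_neq0.

Lemma Tbar2_scaleAl (c : k) (x y : Tbar2) : c *: (x * y) = c *: x * y.
Proof.
have z : Tbar2_mul 0 y = 0 := mul0r (y : Tbar2).
have := mul_linl y c x 0; rewrite addr0 z addr0 => h; exact: esym h.
Qed.

HB.instance Definition _ := GRing.Lmodule_isLalgebra.Build k Tbar2 Tbar2_scaleAl.

Lemma Tbar2_scaleAr (c : k) (x y : Tbar2) : c *: (x * y) = x * (c *: y).
Proof.
have z : Tbar2_mul x 0 = 0 := mulr0 (x : Tbar2).
have := mul_linr x c y 0; rewrite addr0 z addr0 => h; exact: esym h.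
Qed.

HB.instance Definition _ := GRing.Lalgebra_isAlgebra.Build k Tbar2 Tbar2_scaleAr.

End TensorAlgebra.

Section DoubleTensor.
Variables (k : fieldType) (V : lmodType k).

Definition Hbar : Type := Tbar (Tplus V).
HB.instance Definition _ := GRing.Algebra.on Hbar.
Definition Hbar2 : Type := Tbar2 (Tplus V).
HB.instance Definition _ := GRing.Algebra.on Hbar2.

(* A word on V as an element of T(V), viewed in Hbar; the empty word is 1. *)
Definition hword (s : seq V) : Hbar :=
  if s is a :: s' then bar [:: tword (a, s')] else 1.

(* The positions i of s with m_i = true form S; [runs m s] lists, in         *)
(* increasing order, the words on the maximal intervals of consecutive       *)
(* positions in the complement of S.                                         *)
Fixpoint runs (m : bitseq) (s : seq V) : seq (neword V) :=
  match m, s with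
  | true :: m', _ :: s' => runs m' s'
  | false :: m', a :: s' =>
      match m', runs m' s' with
      | false :: _, (b, t) :: r => (a, b :: t) :: r
      | _, r => (a, [::]) :: r
      end
  | _, _ => [::]
  end.

Definition selection (n : nat) (S : {set 'I_n}) : bitseq :=
  [seq i \in S | i <- enum 'I_n].

Definition cop_term (m : bitseq) (s : seq V) : Hbar2 :=
  tens (hword (mask m s)) (bar [seq tword w | w <- runs m s] : Hbar).

(* The sum of the terms indexed by the S such that P holds of 1 \in S (the   *)
(* first letter has index ord0): P = xpredT for the full coproduct, id and   *)
(* negb for its two halves.                                                  *)
Definition cop_word (P : pred bool) (w : neword V) : Hbar2 :=
  \sum_(S : {set 'I_(size w.2).+1} | P (ord0 \in S))
     cop_term (selection S) (letters w).

(* Each letter occurs exactly once on exactly one side of a term. *)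
Lemma runs_letter (m : bitseq) (u v : seq V) :
  size m = size (u ++ 0 :: v) ->
  (exists s1 s2 r, (forall x, mask m (u ++ x :: v) = s1 ++ x :: s2) /\
                   (forall x, runs m (u ++ x :: v) = r)) \/
  (exists s r1 r2 (w : V -> neword V) s1 s2,
    [/\ forall x, mask m (u ++ x :: v) = s,
        forall x, runs m (u ++ x :: v) = r1 ++ w x :: r2
      & forall x, letters (w x) = s1 ++ x :: s2]).
Proof.
elim: u m => [|a u IH] [|b m] //= [sm].
  case: b => /=; first by left; exists [::], (mask m v), (runs m v).
  right; exists (mask m v).
  case: m sm => [|[] m] sm /=.
  - by exists [::], (runs [::] v), (fun x => (x, [::])), [::], [::].
  - by exists [::], (runs (true :: m) v), (fun x => (x, [::])), [::], [::].
  case: (runs (false :: m) v) => [|[b t] r].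
    by exists [::], [::], (fun x => (x, [::])), [::], [::].
  by exists [::], r, (fun x => (x, b :: t)), [::], (b :: t).
case: b => /=.
  case: (IH m sm) => [[s1 [s2 [r [h1 h2]]]]|[s [r1 [r2 [w [s1 [s2 [h1 h2 h3]]]]]]]].
    by left; exists (a :: s1), s2, r; split=> x; rewrite ?h1 ?h2.
  by right; exists (a :: s), r1, r2, w, s1, s2; split=> x; rewrite ?h1 ?h2 ?h3.
case: (IH m sm) => [[s1 [s2 [r [h1 h2]]]]|[s [r1 [r2 [w [s1 [s2 [h1 h2 h3]]]]]]]].
  left; exists s1, s2; case: m sm h1 h2 => [|[] m] sm h1 h2.
  - by case: u {IH} sm h1 h2.
  - by exists ((a, [::]) :: r); split=> x; rewrite ?h1 ?h2.
  exists (if r is (b, t) :: r' then (a, b :: t) :: r' else [:: (a, [::])]).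
  by split=> x; rewrite ?h1 ?h2.
right; case: m sm h1 h2 => [|[] m] sm h1 h2.
- by case: u {IH} sm h1 h2.
- by exists s, ((a, [::]) :: r1), r2, w, s1, s2; split=> // x; rewrite h2.
case: r1 h2 => [|[b t] r1] h2.
  exists s, [::], r2, (fun x => (a, letters (w x))), (a :: s1), s2.
  split=> // x; first by rewrite h2; case: (w x).
  by rewrite /letters /= -h3.
exists s, ((a, b :: t) :: r1), r2, w, s1, s2; split=> // x.
by rewrite h2.
Qed.

Lemma hword_multilin c (u v : seq V) x y :
  hword (u ++ (c *: x + y) :: v)
  = c *: hword (u ++ x :: v) + hword (u ++ y :: v).
Proof.
have E a s : hword (a :: s) = bar [:: tword (a, s)] by [].
have F w : bar [:: tword w] = bar ([::] ++ tword w :: [::]) :> Hbar by [].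
have T w0 w1 w2 : letters w0 = u ++ (c *: x + y) :: v ->
    letters w1 = u ++ x :: v -> letters w2 = u ++ y :: v ->
    tword w0 = c *: tword w1 + tword w2.
  by move=> h0 h1 h2; apply: pgen_rel; exists u, v, x, y.
suff B w0 w1 w2 : letters w0 = u ++ (c *: x + y) :: v ->
    letters w1 = u ++ x :: v -> letters w2 = u ++ y :: v ->
    bar [:: tword w0] = c *: bar [:: tword w1] + bar [:: tword w2] :> Hbar.
  by case: u T B => [|a u] T B /=; apply: B.
move=> h0 h1 h2; apply: pgen_rel.
by exists [::], [::], (tword w1), (tword w2); rewrite /= -(T w0 w1 w2).
Qed.

Lemma cop_term_multilin m c (u v : seq V) x y :
  size m = (size u + size v).+1 ->
  cop_term m (u ++ (c *: x + y) :: v)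
  = c *: cop_term m (u ++ x :: v) + cop_term m (u ++ y :: v).
Proof.
move=> sm; have {}sm : size m = size (u ++ 0 :: v).
  by rewrite sm size_cat addnS.
rewrite /cop_term.
case: (runs_letter sm) =>
    [[s1 [s2 [r [h1 h2]]]]|[s [r1 [r2 [w [s1 [s2 [h1 h2 h3]]]]]]]].
  by rewrite !h1 !h2 hword_multilin; apply: tens_linl.
rewrite !h1 !h2 !map_cat /= -tens_linr; congr tens.
apply: pgen_rel; exists (map (@tword k V) r1), (map (@tword k V) r2).
exists (tword (w x)), (tword (w y)); split=> //; congr (_ ++ _ :: _).
by apply: pgen_rel; exists s1, s2, x, y; rewrite !h3.
Qed.

Lemma size_selection n (S : {set 'I_n}) : size (selection S) = n.
Proof. by rewrite size_map size_enum_ord. Qed.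

Lemma cop_word_respects P :
  respects (@multilin_rel k V (neword V) (@letters V)) (cop_word P).
Proof.
move=> c w0 w1 w2 [u [v [x [y [e0 e1 e2]]]]].
have sz w z : letters w = u ++ z :: v -> size w.2 = (size u + size v)%N.
  by move/(congr1 size); rewrite /= size_cat addnS => -[].
rewrite /cop_word e0 e1 e2 (sz _ _ e0) (sz _ _ e1) (sz _ _ e2).
rewrite scaler_sumr -big_split /=; apply: eq_bigr => S _.
by apply: cop_term_multilin; rewrite size_selection.
Qed.

Definition copT P : {linear Tplus V -> Hbar2} := plift (@cop_word_respects P).

Definition copT_prod (s : seq (Tplus V)) : Hbar2 :=
  \prod_(w <- s) copT xpredT w.

Lemma copT_prod_respects : respects (@multilin_rel k (Tplus V) _ id) copT_prod.
Proof.
move=> c _ _ _ [u [v [x [y [/= -> -> ->]]]]].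
rewrite /copT_prod !big_cat !big_cons /= linearP.
by rewrite mulrDl mulrDr -scalerAl -scalerAr.
Qed.

Definition Delta : {linear Hbar -> Hbar2} := plift copT_prod_respects.

(* Half-coproducts. They live on H = ker counit; all of them are extended    *)
(* linearly by 0 to the unit.                                                *)
Definition half_prod P (s : seq (Tplus V)) : Hbar2 :=
  if s is w :: s' then copT P w * copT_prod s' else 0.

Lemma half_prod_respects P :
  respects (@multilin_rel k (Tplus V) _ id) (half_prod P).
Proof.
move=> c _ _ _ [[|w u] [v [x [y [/= -> -> ->]]]]] /=.
  by rewrite linearP mulrDl -scalerAl.
have r : multilin_rel id c (u ++ (c *: x + y) :: v) (u ++ x :: v) (u ++ y :: v).
  by exists u, v, x, y.
by rewrite (copT_prod_respects r) mulrDr -scalerAr.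
Qed.

Definition half P : {linear Hbar -> Hbar2} := plift (@half_prod_respects P).

Definition Delta_prec_plus : {linear Hbar -> Hbar2} := half id.
Definition Delta_succ_plus : {linear Hbar -> Hbar2} := half negb.

(* The projection of Hbar onto H along the unit. *)
Definition projH (x : Hbar) : Hbar := x - counit x *: 1.

Definition Delta_prec (x : Hbar) : Hbar2 :=
  Delta_prec_plus x - tens (projH x) (1 : Hbar).
Definition Delta_succ (x : Hbar) : Hbar2 :=
  Delta_succ_plus x - tens (1 : Hbar) (projH x).

Lemma projH_linear : linear projH.
Proof.
move=> c x y; rewrite /projH linearP /= scalerDl -scalerA scalerBr.
by rewrite opprD addrACA.
Qed.

Lemma Delta_prec_linear : linear Delta_prec.
Proof.
move=> c x y; rewrite /Delta_prec linearP projH_linear tens_linl.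
by rewrite scalerBr opprD addrACA.
Qed.

Lemma Delta_succ_linear : linear Delta_succ.
Proof.
move=> c x y; rewrite /Delta_succ linearP projH_linear tens_linr.
by rewrite scalerBr opprD addrACA.
Qed.

HB.instance Definition _ :=
  GRing.isLinear.Build k Hbar Hbar2 _ Delta_prec Delta_prec_linear.
HB.instance Definition _ :=
  GRing.isLinear.Build k Hbar Hbar2 _ Delta_succ Delta_succ_linear.

Definition lform : Type := {linear Hbar -> k^o}.

Definition eps : lform := counit.

Definition conv (f g : lform) : lform := tensor_form f g \o Delta.

(* The half-shuffles of forms vanishing on the unit, then extended by        *)
(* bilinearity and  e ≻ f = f = f ≺ e,  e ≺ f = 0 = f ≻ e. The products      *)
(* e ≺ e and e ≻ e, left undefined there, are 0 and are never used.          *)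
Definition prec0 (f g : lform) : lform := tensor_form f g \o Delta_prec.
Definition succ0 (f g : lform) : lform := tensor_form f g \o Delta_succ.

Definition form_add (f g : lform) : lform := f \+ g.
Definition form_scale (c : k) (f : lform) : lform := c \*: f.
Definition form_sub (f g : lform) : lform := f \- g.

Definition reduced (f : lform) : lform := form_sub f (form_scale (f 1) eps).

Definition prec (f g : lform) : lform :=
  form_add (prec0 (reduced f) (reduced g)) (form_scale (g 1) (reduced f)).
Definition succ (f g : lform) : lform :=
  form_add (succ0 (reduced f) (reduced g)) (form_scale (f 1) (reduced g)).

(* The inverse for the convolution product. *)
Definition conv_inv (f : lform) : lform :=
  pick_or eps (fun g => conv f g =1 eps /\ conv g f =1 eps).

(* The solution of Phi = e + alpha ≺ Phi. *)
Definition Eprec (alpha : lform) : lform :=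
  pick_or eps (fun Phi => Phi =1 form_add eps (prec alpha Phi)).

Definition logprec (Phi : lform) : lform :=
  prec (form_sub Phi eps) (conv_inv Phi).
Definition logsucc (Phi : lform) : lform :=
  succ (conv_inv Phi) (form_sub Phi eps).

Definition BPchar (Phi : lform) : lform := Eprec (logsucc Phi).

End DoubleTensor.

Section Character.
Variables (k : fieldType) (A : algType k) (phi : {linear A -> k^o}).

Definition phi_word (w : neword A) : k^o := phi (\prod_(a <- letters w) a).

Lemma phi_word_respects :
  respects (@multilin_rel k A (neword A) (@letters A)) phi_word.
Proof.
move=> c w0 w1 w2 [u [v [x [y [e0 e1 e2]]]]].
rewrite /phi_word e0 e1 e2 !big_cat !big_cons /=.
by rewrite mulrDl mulrDr -scalerAl -scalerAr linearP.
Qed.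

(* phi on T(A), then its multiplicative extension to Hbar. *)
Definition phiT : {linear Tplus A -> k^o} := plift phi_word_respects.

Definition phi_prod (s : seq (Tplus A)) : k^o := \prod_(w <- s) phiT w.

Lemma phi_prod_respects : respects (@multilin_rel k (Tplus A) _ id) phi_prod.
Proof.
move=> c _ _ _ [u [v [x [y [/= -> -> ->]]]]].
rewrite /phi_prod !big_cat !big_cons /= linearP.
by rewrite mulrDl mulrDr -scalerAl -scalerAr.
Qed.

Definition character : lform A := plift phi_prod_respects.

End Character.

Section Series.
Variables (k : fieldType) (n : nat).

Lemma ncpoly_scaleAr (c : k) (p q : {malg k[{fmonom 'I_n}]}) :
  c *: (p * q) = p * (c *: q).
Proof.
apply/malgP=> m; apply: (etrans (mcoeffZ _ _ _)).
apply: (etrans (congr1 (fun z => c * z) (mcoeffMl p q m))).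
apply: (etrans _ (esym (mcoeffMlw m (fsubset_refl (msupp p)) (msuppZ_le c q)))).
rewrite mulr_sumr; apply: eq_bigr => m1 _.
rewrite mulr_sumr; apply: eq_bigr => m2 _.
by rewrite (mcoeffZ c q m2) mulrnAr mulrCA.
Qed.

(* k<X_1, ..., X_n>, the monoid algebra of the free monoid. *)
Definition ncpoly : Type := {malg k[{fmonom 'I_n}]}.
HB.instance Definition _ := GRing.Lalgebra.on ncpoly.

HB.instance Definition _ := GRing.Lalgebra_isAlgebra.Build k ncpoly ncpoly_scaleAr.

Definition ncX (i : 'I_n) : ncpoly := << fmu i >>.

(* Noncommutative power series, as families of coefficients of words. *)
Definition ncseries : Type := seq 'I_n -> k.

(* The sum over the nonempty words w of f(b_w) w. *)
Definition word_series (B : lmodType k) (f : lform B) (b : 'I_n -> B) : ncseries :=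
  fun w => if w is [::] then 0 else f (hword [seq b i | i <- w]).

Definition Rseries (B : lmodType k) (Psi : lform B) (b : 'I_n -> B) : ncseries :=
  word_series (logprec Psi) b.
Definition etaseries (B : lmodType k) (Psi : lform B) (b : 'I_n -> B) : ncseries :=
  word_series (logsucc Psi) b.

Definition nceval (A : algType k) (a : 'I_n -> A) : {linear ncpoly -> A} :=
  free_ext (fun m : {fmonom 'I_n} => \prod_(i <- fmonom_val m) a i).

Definition moment (A : algType k) (phi : {linear A -> k^o}) (a : 'I_n -> A) :
  {linear ncpoly -> k^o} := phi \o nceval a.

Definition Rform (nu : {linear ncpoly -> k^o}) : ncseries :=
  Rseries (character nu) ncX.
Definition etaform (nu : {linear ncpoly -> k^o}) : ncseries :=
  etaseries (character nu) ncX.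

(* The unital form nu' defined by the relation R_(nu') = eta_nu. *)
Definition BPform (nu : {linear ncpoly -> k^o}) : {linear ncpoly -> k^o} :=
  pick_or nu (fun nu' => nu' 1 = 1 /\ Rform nu' = etaform nu).

End Series.

(* Main.v *)
From HB Require Import structures.
Require Import Defs.
From mathcomp Require Import all_boot all_order all_algebra.
From mathcomp Require Import finmap boolp.
From mathcomp.multinomials Require Import monalg.

Set Implicit Arguments.
Unset Strict Implicit.
Unset Printing Implicit Defensive.

Import GRing.Theory.
Local Open Scope ring_scope.

(* A linear form on Hbar is determined by the function ws |-> f (hgen ws) on  *)
(* lists of nonempty words, and on such functions the coproducts become sums  *)
(* over lists of pairs. Colouring the letters of a word with three colours    *)
(* gives coassociativity and (f ≺ g) ≺ h = f ≺ (g * h). The number of letters *)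
(* makes the equations Phi = e + alpha ≺ Phi and Psi * g = e solvable, hence  *)
(* log^≺ (E_≺ alpha) = (alpha ≺ Psi) ≺ Psi^-1 = alpha whenever alpha 1 = 0,   *)
(* and alpha = log^≻ Phi is such a form. The identity with eta_mu holds       *)
(* because splitting words commutes with maps of alphabets, and a             *)
(* convolution inverse on words in n letters is unique. A form with R equal   *)
(* to eta_mu is built by recursion on the length of words, its cumulants      *)
(* being determined by a triangular system.                                   *)

(** * Splittings of words *)

(** The key is the half-associativity (f ≺ g) ≺ h = f ≺ (g * h), [fhalfA]. Both sides distribute the
    letters of a word among three tensor factors, the first letter going to the first factor;
    splitting the left part again or the right part again lists the same distributions
    ([scan3_left], [scan3_right]). If Psi = e + alpha ≺ Psi with alpha(1) = 0, then log^≺(Psi) =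
    (alpha ≺ Psi) ≺ Psi^-1 = alpha ≺ (Psi * Psi^-1) = alpha ≺ e = alpha ([logprec_Eprec]). Taking
    alpha = log^≻(Phi) gives the first identity, on all of [Hbar], hence the equality of the two
    series of the sequence a. Next, the letters X_i under mu have the same moments as the a_i under
    phi, and log^≻ on words in a given alphabet depends only on the values of the character on such
    words ([logsucc_natural]); hence eta_a = eta_mu. Finally, B(mu) is only specified by an
    equation, which must be shown solvable ([BPform_exists]): moments are built recursively from the
    prescribed cumulants, and the cumulants log^≺ of the resulting character obey the same
    triangular system, so they are the prescribed ones. *)

Section Splits.
Variable T : Type.
Implicit Types (s t u v : seq T) (w : neword T) (ws L M N : seq (neword T)).

(** The empty word stands for the unit, which is the empty list of words. *)
Definition flush s : seq (neword T) := if s is a :: s' then [:: (a, s')] else [::].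

(* The letters of s are read from left to right, each being sent to t (the   *)
(* left tensor factor) or appended to the open word v of the right factor; N *)
(* lists the closed words of the right factor.                               *)
Fixpoint scan t N v s : seq (seq T * seq (neword T) * seq T) :=
  if s is a :: s' then
    scan (rcons t a) (N ++ flush v) [::] s' ++ scan t N (rcons v a) s'
  else [:: (t, N, v)].

Definition finish (x : seq T * seq (neword T) * seq T) :
    seq (neword T) * seq (neword T) :=
  (flush x.1.1, x.1.2 ++ flush x.2).

(* P is applied to the truth value of: the first letter goes to the left. *)
Definition wsplit (P : pred bool) w : seq (seq (neword T) * seq (neword T)) :=
  map finish ((if P true then scan [:: w.1] [::] [::] w.2 else [::]) ++
              (if P false then scan [::] [::] [:: w.1] w.2 else [::])).

Definition cat2 (p q : seq (neword T) * seq (neword T)) := (p.1 ++ q.1, p.2 ++ q.2).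

Fixpoint bsplit ws : seq (seq (neword T) * seq (neword T)) :=
  if ws is w :: ws' then [seq cat2 p q | p <- wsplit xpredT w, q <- bsplit ws']
  else [:: ([::], [::])].

Definition hsplit P ws : seq (seq (neword T) * seq (neword T)) :=
  if ws is w :: ws' then [seq cat2 p q | p <- wsplit P w, q <- bsplit ws'] else [::].

Definition weight ws : nat := sumn [seq (size w.2).+1 | w <- ws].

Lemma weight_cat L M : weight (L ++ M) = (weight L + weight M)%N.
Proof. by rewrite /weight map_cat sumn_cat. Qed.

Lemma weight_flush s : weight (flush s) = size s.
Proof. by case: s => //= a s; rewrite /weight /= addn0. Qed.

Lemma scan_cons a t N v s :
  scan (a :: t) N v s = [seq (a :: x.1.1, x.1.2, x.2) | x <- scan t N v s].
Proof. by elim: s t N v => //= b s IH t N v; rewrite !IH map_cat. Qed.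

Section Sums.
Variable R : nmodType.

Lemma scan_rcons (F : seq T * seq (neword T) * seq T -> R) t N v s a :
  \sum_(x <- scan t N v (rcons s a)) F x =
  \sum_(x <- scan t N v s)
    (F (rcons x.1.1 a, x.1.2 ++ flush x.2, [::]) + F (x.1.1, x.1.2, rcons x.2 a)).
Proof.
elim: s t N v => [|b s IH] t N v /=; first by rewrite big_cons !big_seq1.
by rewrite !big_cat /= !IH.
Qed.

Lemma bsplit_flush (F : seq (neword T) * seq (neword T) -> R) s :
  \sum_(p <- bsplit (flush s)) F p = \sum_(x <- scan [::] [::] [::] s) F (finish x).
Proof.
case: s => [|a s]; first by rewrite !big_seq1.
rewrite [LHS]big_allpairs_dep big_map.
by apply: eq_bigr => x _; rewrite big_seq1 /cat2 /= !cats0.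
Qed.

Lemma bsplit_cat (F : seq (neword T) * seq (neword T) -> R) L M :
  \sum_(p <- bsplit (L ++ M)) F p =
  \sum_(p <- bsplit L) \sum_(q <- bsplit M) F (cat2 p q).
Proof.
elim: L F => [|w L IH] F /=.
  by rewrite big_seq1; apply: eq_bigr => -[].
rewrite !big_allpairs_dep; apply: eq_bigr => p _; rewrite IH.
by apply: eq_bigr => q _; apply: eq_bigr => r _; rewrite /cat2 /= !catA.
Qed.

Lemma hsplit_cat (F : seq (neword T) * seq (neword T) -> R) P w M :
  \sum_(p <- hsplit P (w :: M)) F p =
  \sum_(p <- wsplit P w) \sum_(q <- bsplit M) F (cat2 p q).
Proof. exact: big_allpairs_dep. Qed.

Variable F : seq T -> seq (neword T) -> seq (neword T) -> R.

(* Each letter of s goes to one of three tensor factors: an open word of the *)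
(* second factor is closed by a letter of the first, an open word of the     *)
(* third by a letter of the first or of the second.                          *)
Fixpoint scan3 t M u N v s : R :=
  if s is a :: s' then
    scan3 (rcons t a) (M ++ flush u) [::] (N ++ flush v) [::] s' +
    scan3 t M (rcons u a) (N ++ flush v) [::] s' + scan3 t M u N (rcons v a) s'
  else F t (M ++ flush u) (N ++ flush v).

(** The left word grows at its right end, so each new letter extends the inner splitting by one step
    ([scan_rcons]). The first [i] letters are exempt from the inner splitting: [i] is 0 for the full
    coproduct and 1 for its half, whose first letter stays in the first factor. *)
Lemma scan3_left i t0 M0 u0 t N v s : (i <= size t)%N ->
  \sum_(x <- scan t N v s) \sum_(y <- scan t0 M0 u0 (drop i x.1.1))
     F y.1.1 (y.1.2 ++ flush y.2) (x.1.2 ++ flush x.2) =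
  \sum_(y <- scan t0 M0 u0 (drop i t)) scan3 y.1.1 y.1.2 y.2 N v s.
Proof.
elim: s t N v => [|a s IH] t N v it /=; first by rewrite big_seq1.
rewrite big_cat /= IH ?IH // ?size_rcons; last exact: leqW.
by rewrite drop_rcons // scan_rcons -big_split.
Qed.

Lemma scan3_right t C c s :
  \sum_(x <- scan t C c s) \sum_(q <- bsplit (x.1.2 ++ flush x.2)) F x.1.1 q.1 q.2 =
  \sum_(q <- bsplit C) \sum_(y <- scan [::] [::] [::] c)
     scan3 t q.1 y.1.1 (q.2 ++ y.1.2) y.2 s.
Proof.
elim: s t C c => [|a s IH] t C c /=.
  rewrite big_seq1 /= bsplit_cat; apply: eq_bigr => q _.
  by rewrite bsplit_flush; apply: eq_bigr => y _; rewrite /= -catA.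
rewrite big_cat /= !IH bsplit_cat -big_split /=; apply: eq_bigr => q _.
rewrite scan_rcons bsplit_flush -big_split /=; apply: eq_bigr => y _.
by rewrite big_seq1 /= !catA !cats0 addrA.
Qed.

End Sums.

(** * Coassociativity of the full and the left half splittings *)

Section Coassociativity.
Variable R : nmodType.
Implicit Type F : seq (neword T) -> seq (neword T) -> seq (neword T) -> R.

Lemma wsplit_coassoc F w :
  \sum_(p <- wsplit xpredT w) \sum_(q <- bsplit p.1) F q.1 q.2 p.2 =
  \sum_(p <- wsplit xpredT w) \sum_(q <- bsplit p.2) F p.1 q.1 q.2.
Proof.
pose F' t := F (flush t).
have E : wsplit xpredT w = map finish (scan [::] [::] [::] (letters w)) by [].
rewrite E !big_map.
transitivity (scan3 F' [::] [::] [::] [::] [::] (letters w)).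
  under eq_bigr => x _ do rewrite /= bsplit_flush.
  have /= := scan3_left F' [::] [::] [::] [::] [::] (letters w) (leq0n (size (@nil T))).
  rewrite big_seq1 /= => <-.
  by apply: eq_bigr => x _; rewrite drop0.
by have /= := scan3_right F' [::] [::] [::] (letters w); rewrite !big_seq1.
Qed.

Lemma wsplit_half_coassoc F w :
  \sum_(p <- wsplit id w) \sum_(q <- hsplit id p.1) F q.1 q.2 p.2 =
  \sum_(p <- wsplit id w) \sum_(q <- bsplit p.2) F p.1 q.1 q.2.
Proof.
case: w => a s; pose F' t := F (flush t).
rewrite /wsplit /= cats0 !big_map.
transitivity (scan3 F' [:: a] [::] [::] [::] [::] s).
  have /= := scan3_left F' (i := 1) [:: a] [::] [::] (t := [:: a]) [::] [::] s (leqnn 1).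
  rewrite big_seq1 /= => <-.
  rewrite !scan_cons !big_map; apply: eq_bigr => x _.
  rewrite [LHS]hsplit_cat /wsplit /= drop0 cats0 big_map; apply: eq_bigr => y _.
  by rewrite big_seq1 /= !cats0.
by have /= := scan3_right F' [:: a] [::] [::] s; rewrite !big_seq1.
Qed.

Lemma bsplit_coassoc F ws :
  \sum_(p <- bsplit ws) \sum_(q <- bsplit p.1) F q.1 q.2 p.2 =
  \sum_(p <- bsplit ws) \sum_(q <- bsplit p.2) F p.1 q.1 q.2.
Proof.
elim: ws F => [|w ws IH] F; first by rewrite !big_seq1.
rewrite !big_allpairs_dep.
under eq_bigr => p _ do under eq_bigr => p' _ do rewrite bsplit_cat.
under eq_bigr => p _ do rewrite exchange_big.
under [RHS]eq_bigr => p _ do under eq_bigr => p' _ do rewrite bsplit_cat.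
under [RHS]eq_bigr => p _ do rewrite exchange_big.
rewrite (wsplit_coassoc (fun a b c => \sum_(p' <- bsplit ws) \sum_(q' <- bsplit p'.1)
   F (a ++ q'.1) (b ++ q'.2) (c ++ p'.2))).
apply: eq_bigr => p _; apply: eq_bigr => q _.
exact: (IH (fun a b c => F (p.1 ++ a) (q.1 ++ b) (q.2 ++ c))).
Qed.

Lemma hsplit_coassoc F ws :
  \sum_(p <- hsplit id ws) \sum_(q <- hsplit id p.1) F q.1 q.2 p.2 =
  \sum_(p <- hsplit id ws) \sum_(q <- bsplit p.2) F p.1 q.1 q.2.
Proof.
case: ws => [|w ws]; first by rewrite !big_nil.
rewrite !big_allpairs_dep.
transitivity (\sum_(p <- wsplit id w) \sum_(q <- hsplit id p.1)
   \sum_(p' <- bsplit ws) \sum_(q' <- bsplit p'.1)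
   F (q.1 ++ q'.1) (q.2 ++ q'.2) (p.2 ++ p'.2)).
  (* [scan_cons] exhibits the left part of a split of [w] as one nonempty word; the half splitting
     therefore acts on that word, and the words coming from [ws] are split in full. *)
  case: w => a s; rewrite /wsplit /= cats0 scan_cons !big_map.
  apply: eq_bigr => x _; rewrite [RHS]exchange_big.
apply: eq_bigr => p' _.
  rewrite [LHS]hsplit_cat [RHS]hsplit_cat; apply: eq_bigr => q _.
  by rewrite big_seq1 /= !cats0.
rewrite (wsplit_half_coassoc (fun a b c => \sum_(p' <- bsplit ws) \sum_(q' <- bsplit p'.1)
   F (a ++ q'.1) (b ++ q'.2) (c ++ p'.2))).
apply: eq_bigr => p _.
under [RHS]eq_bigr => p' _ do rewrite bsplit_cat.
rewrite [RHS]exchange_big /=; apply: eq_bigr => q _.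
exact: (bsplit_coassoc (fun a b c => F (p.1 ++ a) (q.1 ++ b) (q.2 ++ c))).
Qed.
End Coassociativity.

(** * Counit identities *)

Section Counits.
Variable R : nmodType.

Lemma scan_counitr (F : seq T -> R) t N v s :
  \sum_(x <- scan t N v s) F x.1.1 *+ nilp (x.1.2 ++ flush x.2) =
  F (t ++ s) *+ nilp (N ++ flush v).
Proof.
elim: s t N v => [|a s IH] t N v /=; first by rewrite big_seq1 cats0.
rewrite big_cat /= !IH /= cats0 cat_rcons.
have -> : nilp (N ++ flush (rcons v a)) = false by case: N; case: v.
by rewrite mulr0n addr0.
Qed.

Lemma scan_counitl (F : seq (neword T) -> R) t N v s :
  \sum_(x <- scan t N v s) F (x.1.2 ++ flush x.2) *+ nilp (flush x.1.1) =
  F (N ++ flush (v ++ s)) *+ nilp t.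
Proof.
elim: s t N v => [|a s IH] t N v /=; first by rewrite big_seq1 cats0; case: t.
rewrite big_cat /= !IH /= cat_rcons.
have -> : nilp (rcons t a) = false by case: t.
by rewrite mulr0n add0r.
Qed.

Lemma wsplit_counitr (F : seq (neword T) -> R) P w :
  \sum_(p <- wsplit P w) F p.1 *+ nilp p.2 = F [:: w] *+ P true.
Proof.
rewrite /wsplit big_map big_cat; case: w => a s /=.
by do 2![case: (P _); rewrite ?(scan_counitr (F \o flush)) ?big_nil /= ?addr0].
Qed.

Lemma wsplit_counitl (F : seq (neword T) -> R) P w :
  \sum_(p <- wsplit P w) F p.2 *+ nilp p.1 = F [:: w] *+ P false.
Proof.
rewrite /wsplit big_map big_cat; case: w => a s /=.
by do 2![case: (P _); rewrite ?scan_counitl ?big_nil /= ?add0r ?addr0].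
Qed.

Lemma nilp_cat (U : Type) (r1 r2 : seq U) : nilp (r1 ++ r2) = nilp r1 && nilp r2.
Proof. by case: r1. Qed.

Lemma bsplit_counitr (F : seq (neword T) -> R) ws :
  \sum_(p <- bsplit ws) F p.1 *+ nilp p.2 = F ws.
Proof.
elim: ws F => [|w ws IH] F; first by rewrite big_seq1.
rewrite big_allpairs_dep -[RHS](wsplit_counitr (fun L => F (L ++ ws)) xpredT w).
apply: eq_bigr => p _; rewrite -(IH (fun L => F (p.1 ++ L))) -sumrMnl.
by apply: eq_bigr => q _; rewrite nilp_cat -mulnb mulnC mulrnA.
Qed.

Lemma bsplit_counitl (F : seq (neword T) -> R) ws :
  \sum_(p <- bsplit ws) F p.2 *+ nilp p.1 = F ws.
Proof.
elim: ws F => [|w ws IH] F; first by rewrite big_seq1.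
rewrite big_allpairs_dep -[RHS](wsplit_counitl (fun L => F (L ++ ws)) xpredT w).
apply: eq_bigr => p _; rewrite -(IH (fun L => F (p.2 ++ L))) -sumrMnl.
by apply: eq_bigr => q _; rewrite nilp_cat -mulnb mulnC mulrnA.
Qed.

Lemma hsplit_counitr (F : seq (neword T) -> R) P ws :
  \sum_(p <- hsplit P ws) F p.1 *+ nilp p.2 = F ws *+ (P true && ~~ nilp ws).
Proof.
case: ws => [|w ws]; first by rewrite big_nil andbF mulr0n.
rewrite hsplit_cat andbT -[RHS](wsplit_counitr (fun L => F (L ++ ws)) P w).
apply: eq_bigr => p _; rewrite -(bsplit_counitr (fun L => F (p.1 ++ L))) -sumrMnl.
by apply: eq_bigr => q _; rewrite nilp_cat -mulnb mulnC mulrnA.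
Qed.

Lemma hsplit_counitl (F : seq (neword T) -> R) P ws :
  \sum_(p <- hsplit P ws) F p.2 *+ nilp p.1 = F ws *+ (P false && ~~ nilp ws).
Proof.
case: ws => [|w ws]; first by rewrite big_nil andbF mulr0n.
rewrite hsplit_cat andbT -[RHS](wsplit_counitl (fun L => F (L ++ ws)) P w).
apply: eq_bigr => p _; rewrite -(bsplit_counitl (fun L => F (p.2 ++ L))) -sumrMnl.
by apply: eq_bigr => q _; rewrite nilp_cat -mulnb mulnC mulrnA.
Qed.
End Counits.

(** * Grading by the number of letters *)

Lemma eq_big_all (R : nmodType) (I : Type) (r : seq I) (P : pred I) (F G : I -> R) :
  all P r -> (forall i, P i -> F i = G i) -> \sum_(i <- r) F i = \sum_(i <- r) G i.
Proof.
move=> + FG; elim: r => [|i r IH] /=; first by rewrite !big_nil.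
by case/andP=> /FG Fi /IH E; rewrite !big_cons Fi E.
Qed.

Lemma scan_weight t N v s :
  all (fun x => size x.1.1 + weight x.1.2 + size x.2 ==
                size t + weight N + size v + size s)%N (scan t N v s).
Proof.
elim: s t N v => [|a s IH] t N v /=; first by rewrite addn0 eqxx.
rewrite all_cat; apply/andP;
  split; [have := IH (rcons t a) (N ++ flush v) [::] | have := IH t N (rcons v a)].
  apply: sub_all => x /eqP ->.
  by rewrite size_rcons weight_cat weight_flush /= addn0 !addnA addnS !addSn.
by apply: sub_all => x /eqP ->; rewrite size_rcons addnS addSn addnS.
Qed.

Definition balanced n (p : seq (neword T) * seq (neword T)) :=
  (weight p.1 + weight p.2 == n)%N.

Lemma balanced_finish n x :
  (size x.1.1 + weight x.1.2 + size x.2 == n)%N -> balanced n (finish x).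
Proof. by rewrite /balanced /= weight_cat !weight_flush addnA. Qed.

Lemma wsplit_balanced P w : all (balanced (weight [:: w])) (wsplit P w).
Proof.
rewrite all_map all_cat; apply/andP; split; case: ifP => // _.
  have := scan_weight [:: w.1] [::] [::] w.2; apply: sub_all => x h.
  by apply: balanced_finish; move: h; rewrite /weight /= !addn0 add1n.
have := scan_weight [::] [::] [:: w.1] w.2; apply: sub_all => x h.
by apply: balanced_finish; move: h; rewrite /weight /= !addn0 add0n add1n.
Qed.

Lemma all_allpairs (I J K : Type) (A : pred I) (B : pred J) (C : pred K)
    (f : I -> J -> K) r r' :
  all A r -> all B r' -> (forall i j, A i -> B j -> C (f i j)) ->
  all C [seq f i j | i <- r, j <- r'].
Proof.
move=> + Br fC; elim: r => //= i r IH /andP[Ai /IH]; rewrite all_cat => ->.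
by rewrite andbT all_map; apply: sub_all Br => j; apply: fC.
Qed.

Lemma cat2_balanced m n p q :
  balanced m p -> balanced n q -> balanced (m + n) (cat2 p q).
Proof. by rewrite /balanced !weight_cat addnACA => /eqP -> /eqP ->. Qed.

Lemma bsplit_balanced ws : all (balanced (weight ws)) (bsplit ws).
Proof.
elim: ws => //= w ws IH; apply: (all_allpairs (wsplit_balanced _ w) IH).
by move=> p q; rewrite (weight_cat [:: w] ws); apply: cat2_balanced.
Qed.

Lemma hsplit_balanced P ws : all (balanced (weight ws)) (hsplit P ws).
Proof.
case: ws => //= w ws; apply: (all_allpairs (wsplit_balanced _ w) (bsplit_balanced ws)).
by move=> p q; rewrite (weight_cat [:: w] ws); apply: cat2_balanced.
Qed.

(** The first letter goes to the left, and the letters on the left form a single word. So only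
    values on single words enter on the left, and the right part is strictly shorter than [w]. *)
Lemma hsplit_single w :
  all (fun p => (size p.1 == 1) && (0 < weight p.1))%N (hsplit id [:: w]).
Proof.
have -> : hsplit id [:: w] = [seq cat2 p q | p <- wsplit id w, q <- bsplit [::]] by [].
apply: (@all_allpairs _ _ _ (fun p => size p.1 == 1%N) (fun q => nilp q.1)) => //.
  by rewrite /wsplit /= cats0 scan_cons !all_map; elim: (scan _ _ _ _).
by move=> [[|u [|? ?]] L] [[|? ?] M].
Qed.

(** * Convolution and half-products of functions on lists of words *)

Section Convolution.
Variable R : pzSemiRingType.
Implicit Types F G K : seq (neword T) -> R.

Definition fconv F G ws := \sum_(p <- bsplit ws) F p.1 * G p.2.
(** For [P := id] and [P := negb] these are dual to Δ^+_≺ and Δ^+_≻: the terms x ⊗ 1 and 1 ⊗ x are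
    kept. *)
Definition fhalf P F G ws := \sum_(p <- hsplit P ws) F p.1 * G p.2.
Definition funit ws : R := (nilp ws)%:R.

Lemma eq_fconv F F' G G' : F =1 F' -> G =1 G' -> fconv F G =1 fconv F' G'.
Proof. by move=> eF eG ws; apply: eq_bigr => p _; rewrite eF eG. Qed.

Lemma eq_fhalf P F F' G G' : F =1 F' -> G =1 G' -> fhalf P F G =1 fhalf P F' G'.
Proof. by move=> eF eG ws; apply: eq_bigr => p _; rewrite eF eG. Qed.

Lemma fconvA F G K : fconv (fconv F G) K =1 fconv F (fconv G K).
Proof.
move=> ws; rewrite /fconv.
under eq_bigr => p _ do rewrite mulr_suml.
rewrite (bsplit_coassoc (fun a b c => F a * G b * K c)).
by apply: eq_bigr => p _; rewrite mulr_sumr; apply: eq_bigr => q _; rewrite mulrA.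
Qed.

Lemma fhalfA F G K : fhalf id (fhalf id F G) K =1 fhalf id F (fconv G K).
Proof.
move=> ws; rewrite /fhalf.
under eq_bigr => p _ do rewrite mulr_suml.
rewrite (hsplit_coassoc (fun a b c => F a * G b * K c)).
by apply: eq_bigr => p _; rewrite mulr_sumr; apply: eq_bigr => q _; rewrite mulrA.
Qed.

Lemma fconv1r F : fconv F funit =1 F.
Proof.
by move=> ws; rewrite -[RHS]bsplit_counitr; apply: eq_bigr => p _; rewrite mulr_natr.
Qed.

Lemma fconv1l F : fconv funit F =1 F.
Proof.
by move=> ws; rewrite -[RHS]bsplit_counitl; apply: eq_bigr => p _; rewrite mulr_natl.
Qed.

Lemma fhalf1r P F ws : fhalf P F funit ws = F ws *+ (P true && ~~ nilp ws).
Proof. by rewrite -hsplit_counitr; apply: eq_bigr => p _; rewrite mulr_natr. Qed.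

Lemma fhalf1l P F ws : fhalf P funit F ws = F ws *+ (P false && ~~ nilp ws).
Proof. by rewrite -hsplit_counitl; apply: eq_bigr => p _; rewrite mulr_natl. Qed.

Lemma fconv_inv_uniq F G G' :
  fconv G F =1 funit -> fconv F G' =1 funit -> G =1 G'.
Proof.
move=> GF FG ws; rewrite -[LHS]fconv1r -(eq_fconv (frefl _) FG) -fconvA.
by rewrite (eq_fconv GF (frefl _)) fconv1l.
Qed.

End Convolution.

(** * Moments determined by free cumulants *)

Section FreeMoments.
Variables (R : pzSemiRingType) (kappa : seq (neword T) -> R).

(** The moment-cumulant recursion with fuel [d]; the number of letters of [w] is enough fuel, since
    the words on the right are shorter. *)
Fixpoint moment_iter d w : R :=
  if d is d'.+1 then
    \sum_(p <- hsplit id [:: w]) kappa p.1 * \prod_(u <- p.2) moment_iter d' u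
  else 0.

Lemma eq_prod_weight n (F G : neword T -> R) L :
  (forall u : neword T, weight [:: u] <= n -> F u = G u)%N -> (weight L <= n)%N ->
  \prod_(u <- L) F u = \prod_(u <- L) G u.
Proof.
move=> FG; elim: L => [|u L IH]; first by rewrite !big_nil.
rewrite (weight_cat [:: u]) => le_n; rewrite !big_cons FG ?IH //.
  exact: leq_trans (leq_addl _ _) le_n.
exact: leq_trans (leq_addr _ _) le_n.
Qed.

Lemma eq_moment_sum n (F G : neword T -> R) w :
  (forall u : neword T, weight [:: u] <= n -> F u = G u)%N ->
  (weight [:: w] <= n.+1)%N ->
  \sum_(p <- hsplit id [:: w]) kappa p.1 * \prod_(u <- p.2) F u =
  \sum_(p <- hsplit id [:: w]) kappa p.1 * \prod_(u <- p.2) G u.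
Proof.
move=> FG le_w; have both : all (fun p => balanced (weight [:: w]) p &&
    ((size p.1 == 1) && (0 < weight p.1)))%N (hsplit id [:: w]).
  by rewrite all_predI hsplit_balanced hsplit_single.
apply: (eq_big_all both) => p /and3P[/eqP bal _ gt0].
rewrite (eq_prod_weight FG) // -ltnS; apply: leq_trans le_w.
by rewrite -bal -(add1n (weight p.2)) leq_add2r.
Qed.

Lemma moment_iter_stable d w :
  (weight [:: w] <= d)%N -> moment_iter d w = moment_iter d.+1 w.
Proof. by elim: d w => [//|d IH] w; apply: eq_moment_sum. Qed.

Lemma moment_exists : exists N : neword T -> R, forall w,
  N w = \sum_(p <- hsplit id [:: w]) kappa p.1 * \prod_(u <- p.2) N u.
Proof.
pose N w := moment_iter (weight [:: w]) w; exists N => w.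
have stable d (u : neword T) : (weight [:: u] <= d)%N -> moment_iter d u = N u.
  move=> /subnK <-; elim: (d - _)%N => // j IH.
  by rewrite addSn -moment_iter_stable ?leq_addl.
rewrite -(stable _ w (leqnSn _)).
exact: (eq_moment_sum (stable _) (leqnSn _)).
Qed.

End FreeMoments.

(* In fhalf id D G [:: w], D is taken at w itself exactly once, and otherwise *)
(* at shorter words.                                                          *)
Lemma hsplit_triangular (R : pzRingType) (D G : seq (neword T) -> R) :
  G [::] = 1 -> (forall w, fhalf id D G [:: w] = 0) -> forall w, D [:: w] = 0.
Proof.
move=> G1 D0 w; have [n] := ubnP (weight [:: w]); elim: n w => // n IH w le_w.
have both : all (fun p => balanced (weight [:: w]) p &&
    ((size p.1 == 1) && (0 < weight p.1)))%N (hsplit id [:: w]).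
  by rewrite all_predI hsplit_balanced hsplit_single.
rewrite -[LHS]mulr1n -(hsplit_counitr D id [:: w]).
transitivity (fhalf id D G [:: w]); last exact: D0.
apply: (eq_big_all both) => -[[|t [|? ?]] M] /and3P[/eqP bal] // _ _.
case: M bal => [|u M] bal /=; first by rewrite G1 mulr1.
rewrite (IH t) ?mul0r //.
by rewrite -ltnS (leq_trans _ le_w) // ltnS -bal -[X in (X < _)%N]addn0 ltn_add2l.
Qed.

End Splits.

(** * Naturality of splittings in the alphabet *)

Section Naturality.
Variables (T U : Type) (f : T -> U).

Definition nemap (w : neword T) : neword U := (f w.1, map f w.2).
Definition nemap2 (p : seq (neword T) * seq (neword T)) :=
  (map nemap p.1, map nemap p.2).

Lemma flush_map s : flush (map f s) = map nemap (flush s).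
Proof. by case: s. Qed.

Lemma scan_map t N v s :
  scan (map f t) (map nemap N) (map f v) (map f s) =
  [seq (map f x.1.1, map nemap x.1.2, map f x.2) | x <- scan t N v s].
Proof.
elim: s t N v => //= a s IH t N v; rewrite map_cat -!IH !map_rcons map_cat.
by rewrite flush_map.
Qed.

Lemma wsplit_map P w : wsplit P (nemap w) = map nemap2 (wsplit P w).
Proof.
rewrite /wsplit /= -!map_comp.
have E : @finish U \o (fun x => (map f x.1.1, map nemap x.1.2, map f x.2)) =1
         nemap2 \o @finish T.
  by move=> [[t N] v]; rewrite /finish /nemap2 /= !flush_map map_cat.
rewrite -(eq_map E) [RHS]map_comp [in RHS]map_cat.
congr map.
congr (_ ++ _); case: ifP => // _.
- exact: scan_map [:: _] [::] [::] _.
- exact: scan_map [::] [::] [:: _] _.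
Qed.

Lemma nemap2_cat p q : nemap2 (cat2 p q) = cat2 (nemap2 p) (nemap2 q).
Proof. by rewrite /nemap2 /= !map_cat. Qed.

Lemma bsplit_map ws : bsplit (map nemap ws) = map nemap2 (bsplit ws).
Proof.
elim: ws => //= w ws ->; rewrite wsplit_map map_allpairs allpairs_mapl allpairs_mapr.
by apply: eq_allpairs => p q; rewrite nemap2_cat.
Qed.

Lemma hsplit_map P ws : hsplit P (map nemap ws) = map nemap2 (hsplit P ws).
Proof.
case: ws => //= w ws.
rewrite bsplit_map wsplit_map map_allpairs allpairs_mapl allpairs_mapr.
by apply: eq_allpairs => p q; rewrite nemap2_cat.
Qed.

Section Pullback.
Variables (R : pzSemiRingType) (F G : seq (neword U) -> R).

Lemma fconv_map : fconv F G \o map nemap =1 fconv (F \o map nemap) (G \o map nemap).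
Proof. by move=> ws; rewrite /fconv /= bsplit_map big_map. Qed.

Lemma fhalf_map P :
  fhalf P F G \o map nemap =1 fhalf P (F \o map nemap) (G \o map nemap).
Proof. by move=> ws; rewrite /fhalf /= hsplit_map big_map. Qed.

Lemma funit_map : @funit U R \o map nemap =1 @funit T R.
Proof. by case. Qed.
End Pullback.
End Naturality.

(** * Linear forms on generators *)

Fixpoint masks n : seq bitseq :=
  if n is n'.+1 then map (cons true) (masks n') ++ map (cons false) (masks n')
  else [:: [::]].

Lemma masksS n : masks n.+1 = map (cons true) (masks n) ++ map (cons false) (masks n).
Proof. by []. Qed.

Lemma mem_masks n (m : bitseq) : (m \in masks n) = (size m == n).
Proof.
elim: n m => [|n IH] [|b m] //=; rewrite mem_cat.
  by apply/negbTE/negP=> /orP[] /mapP[].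
have inj c : injective (cons c) by move=> x y [].
rewrite eqSS -IH; case: b; rewrite mem_map; try exact: inj.
  by rewrite orb_idr // => /mapP[].
by rewrite orb_idl // => /mapP[].
Qed.

Lemma uniq_masks n : uniq (masks n).
Proof.
elim: n => //= n IH; have inj c : injective (cons c) by move=> x y [].
rewrite cat_uniq !(map_inj_uniq (inj _ _)) IH /= andbT.
by apply/hasPn=> _ /mapP[m _ ->]; apply/mapP=> -[].
Qed.

Lemma nth_selection n (S : {set 'I_n}) (i : 'I_n) :
  nth false (selection S) i = (i \in S).
Proof. by rewrite (nth_map i) ?size_enum_ord // nth_ord_enum. Qed.

Lemma perm_selection n : perm_eq [seq selection B | B : {set 'I_n}] (masks n).
Proof.
have inj : injective (@selection n).
  by move=> S1 S2 E; apply/setP=> i; rewrite -!nth_selection E.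
apply: uniq_perm; rewrite ?uniq_masks //; first by rewrite map_inj_uniq ?enum_uniq.
move=> m; rewrite mem_masks; apply/mapP/eqP => [[S _ ->]|sm].
  exact: size_selection.
exists [set i | nth false m (val i)]; first by rewrite mem_enum.
apply: (@eq_from_nth _ false); rewrite ?size_selection sm // => i lt_i.
by rewrite (nth_selection _ (Ordinal lt_i)) inE.
Qed.

Lemma sum_selection (R : nmodType) n (P : pred bitseq) (F : bitseq -> R) :
  \sum_(S : {set 'I_n} | P (selection S)) F (selection S) =
  \sum_(m <- masks n | P m) F m.
Proof. by rewrite -(perm_big _ (perm_selection n)) big_map big_enum_cond. Qed.

Lemma pick_orP (T : Type) (x0 : T) (P : T -> Prop) : (exists x, P x) -> P (pick_or x0 P).
Proof. by rewrite /pick_or; case: pselect => // ex _; case: (cid _). Qed.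

Section Generators.
Variables (k : fieldType) (V : lmodType k).

Definition hgen (ws : seq (neword V)) : Hbar V := bar [seq tword w | w <- ws].

Lemma hgen0 : hgen [::] = 1. Proof. by []. Qed.

Lemma hgen_cat L M : hgen (L ++ M) = hgen L * hgen M.
Proof. by rewrite /hgen map_cat bar_cat. Qed.

Lemma hword_flush (s : seq V) : hword s = hgen (flush s).
Proof. by case: s. Qed.

(* The words on the right of a term when the unselected word v immediately  *)
(* precedes s.                                                              *)
Definition glue (v : seq V) (m : bitseq) (s : seq V) : seq (neword V) :=
  if m is false :: _ then
    if runs m s is (b, t) :: r then flush (v ++ b :: t) ++ r else flush v
  else flush v ++ runs m s.

Lemma glue0 m s : glue [::] m s = runs m s.
Proof. by case: m => [|[] m] //; rewrite /glue; case: (runs _ _) => [|[]]. Qed.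

Lemma glue_true v m a s : glue v (true :: m) (a :: s) = flush v ++ runs m s.
Proof. by []. Qed.

Lemma glue_false v m a s : glue v (false :: m) (a :: s) = glue (rcons v a) m s.
Proof.
case: m => [|[] m]; rewrite /glue.
- by rewrite -cats1.
- by rewrite [runs (false :: _) _]/= -cats1.
rewrite [runs (false :: false :: _) _]/=.
by case: (runs (false :: m) s) => [|[b t] r]; rewrite ?cat_rcons ?cats0 ?cats1.
Qed.

(** [runs] looks ahead to decide whether a run continues, [scan] remembers the run behind it.
    Generalizing over the open word [v], through [glue], reconciles the two recursions. *)
Lemma sum_scan (R : nmodType) (F : seq (neword V) * seq (neword V) -> R) t N v s :
  \sum_(x <- scan t N v s) F (finish x) =
  \sum_(m <- masks (size s)) F (flush (t ++ mask m s), N ++ glue v m s).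
Proof.
elim: s t N v => [|a s IH] t N v; first by rewrite !big_seq1 /= /finish !cats0.
rewrite /= !big_cat /= !big_map !IH; congr (_ + _); apply: eq_bigr => m _.
  by rewrite glue0 glue_true cat_rcons catA.
by rewrite glue_false.
Qed.

Lemma copT_tword P (w : neword V) :
  copT V P (tword w) = \sum_(p <- wsplit P w) tens (hgen p.1) (hgen p.2).
Proof.
rewrite plift_gen /cop_word.
transitivity (\sum_(m <- masks (size w.2).+1 | P (nth false m 0))
     (tens (hgen (flush (mask m (letters w)))) (hgen (runs m (letters w))) : Hbar2 V)).
  rewrite -sum_selection; apply: eq_big => [S|S _].
    by rewrite -(nth_selection S ord0).
  by rewrite /cop_term hword_flush.
have E b : \sum_(m <- masks (size w.2) | P b)
     (tens (hgen (flush (mask (b :: m) (letters w))))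
           (hgen (runs (b :: m) (letters w))) : Hbar2 V) =
   \sum_(p <- map (@finish V) (if P b then if b then scan [:: w.1] [::] [::] w.2
     else scan [::] [::] [:: w.1] w.2 else [::])) tens (hgen p.1) (hgen p.2).
  rewrite big_map; case: (P b); last by rewrite big_nil big_pred0.
  case: b; rewrite (sum_scan (fun p => tens (hgen p.1) (hgen p.2) : Hbar2 V)).
    by apply: eq_bigr => m _; rewrite glue0.
  by apply: eq_bigr => m _; rewrite -[[:: w.1]]/(rcons [::] w.1) -glue_false glue0.
rewrite masksS big_cat 2!big_map /wsplit map_cat [RHS]big_cat.
by congr (_ + _); [exact: (E true) | exact: (E false)].
Qed.

Lemma tensM (x y x' y' : Hbar V) :
  (tens x y : Hbar2 V) * tens x' y' = tens (x * x') (y * y').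
Proof. exact: Tbar2_mul_tens. Qed.

Lemma Delta_hgen ws :
  Delta V (hgen ws) = \sum_(p <- bsplit ws) tens (hgen p.1) (hgen p.2).
Proof.
rewrite plift_gen /copT_prod big_map.
elim: ws => [|w ws IH]; first by rewrite big_nil big_seq1.
rewrite big_cons IH copT_tword big_allpairs_dep mulr_suml; apply: eq_bigr => p _.
by rewrite mulr_sumr; apply: eq_bigr => q _; rewrite tensM !hgen_cat.
Qed.

Lemma half_hgen P ws :
  Defs.half V P (hgen ws) = \sum_(p <- hsplit P ws) tens (hgen p.1) (hgen p.2).
Proof.
rewrite plift_gen; case: ws => [|w ws]; first by rewrite big_nil.
have := Delta_hgen ws; rewrite plift_gen /half_prod /= => ->.
rewrite copT_tword big_allpairs_dep mulr_suml; apply: eq_bigr => p _.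
by rewrite mulr_sumr; apply: eq_bigr => q _; rewrite tensM !hgen_cat.
Qed.

Lemma bar1_linear : linear (fun t : Tplus V => bar [:: t] : Hbar V).
Proof. by move=> c x y; apply: pgen_rel; exists [::], [::], x, y. Qed.

(** The [hgen ws] span [Hbar]: the entries of a bar word are elements of T(V), and each is expanded
    in words, one after the other. *)
Lemma Hbar_ind (Q : Hbar V -> Prop) :
  Q 0 -> (forall c ws x, Q x -> Q (c *: hgen ws + x)) -> forall x, Q x.
Proof.
(* [Q] is not assumed stable under sums, but [S] is stable under linear combinations and can be
   carried through the expansion of each entry. *)
move=> Q0 QD; pose S x := forall c y, Q y -> Q (c *: x + y).
have SP c x y : S x -> S y -> S (c *: x + y).
  by move=> Sx Sy d z Qz; rewrite scalerDr scalerA -addrA; apply/Sx/Sy.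
have Sbar s ws : S (hgen ws * bar s).
  elim: s ws => [|t s IH] ws; first by rewrite mulr1 => c y; apply: QD.
  rewrite -cat1s bar_cat mulrA.
  elim/pres_ind: t => [|c w t St].
    have := bar1_linear (-1) 0 0; rewrite scaler0 addr0 scaleN1r addNr => ->.
    by rewrite mulr0 mul0r => c y; rewrite scaler0 add0r.
  rewrite bar1_linear mulrDr -scalerAr mulrDl -scalerAl; apply: SP => //.
  by have := IH (ws ++ [:: w]); rewrite hgen_cat.
elim/pres_ind=> // c s x Qx; have := Sbar s [::] c x Qx.
by rewrite hgen0 mul1r.
Qed.

Lemma lform_ext (f g : lform V) : (forall ws, f (hgen ws) = g (hgen ws)) -> f =1 g.
Proof.
by move=> fg; elim/Hbar_ind=> [|c ws x IH]; rewrite ?linear0 // !linearP fg IH.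
Qed.

Definition at_gen (f : lform V) (ws : seq (neword V)) : k := f (hgen ws).

Lemma eps_gen : at_gen (eps V) =1 @funit V k.
Proof. by move=> ws; rewrite /at_gen /eps counit_bar /funit; case: ws. Qed.

Lemma conv_gen f g : at_gen (conv f g) =1 fconv (at_gen f) (at_gen g).
Proof.
move=> ws; rewrite /at_gen /conv /= Delta_hgen linear_sum.
by apply: eq_bigr => p _; rewrite tensor_form_tens.
Qed.

Definition half_form P (f g : lform V) : lform V := tensor_form f g \o Defs.half V P.

Lemma half_form_gen P f g :
  at_gen (half_form P f g) =1 fhalf P (at_gen f) (at_gen g).
Proof.
move=> ws; rewrite /at_gen /half_form /= half_hgen linear_sum.
by apply: eq_bigr => p _; rewrite tensor_form_tens.
Qed.

Lemma reduced_gen (f : lform V) ws : at_gen (reduced f) ws = at_gen f ws *+ ~~ nilp ws.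
Proof.
rewrite /at_gen /reduced /= -[eps V _]/(at_gen (eps V) ws) eps_gen /funit.
rewrite -[_ *: _]/(_ * _).
case: ws => [|w ws]; first by rewrite /= hgen0 mulr1 subrr.
by rewrite /= mulr0 subr0.
Qed.

Lemma gen_reduced (f : lform V) ws :
  at_gen f ws = at_gen (reduced f) ws + f 1 * funit k ws.
Proof.
rewrite reduced_gen /funit; case: ws => [|w ws] /=; last by rewrite mulr0 addr0.
by rewrite add0r mulr1 /at_gen hgen0.
Qed.

Lemma reduced1 (f : lform V) : reduced f 1 = 0.
Proof. by rewrite -hgen0 -[LHS]/(at_gen _ _) reduced_gen. Qed.

(** The term x ⊗ 1 removed in [Delta_prec] is killed because [reduced g] vanishes at 1. The
    extension term g(1) f is what the constant part g(1) e of g contributes through Δ^+_≺. So the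
    uncorrected half-coproduct computes f ≺ g with g left unreduced. *)
Lemma prec_gen (f g : lform V) :
  at_gen (prec f g) =1 fhalf id (at_gen (reduced f)) (at_gen g).
Proof.
move=> ws; have -> : at_gen (prec f g) ws =
    at_gen (half_form id (reduced f) (reduced g)) ws + g 1 * at_gen (reduced f) ws.
  have E : prec0 (reduced f) (reduced g) (hgen ws) =
      half_form id (reduced f) (reduced g) (hgen ws).
    by rewrite /prec0 /= /Delta_prec linearB /= tensor_form_tens reduced1 mulr0 subr0.
  exact: (congr1 (fun z => z + g 1 * at_gen (reduced f) ws) E).
rewrite half_form_gen /fhalf [RHS](eq_bigr _ (fun p _ => congr1 _ (gen_reduced g p.2))).
under [RHS]eq_bigr => p _ do rewrite mulrDr mulrCA.
rewrite big_split -mulr_sumr; congr (_ + _ * _).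
have := fhalf1r id (at_gen (reduced f)) ws; rewrite /fhalf => ->.
by rewrite reduced_gen -mulrnA mulnb andbb.
Qed.

Lemma succ_gen (f g : lform V) :
  at_gen (succ f g) =1 fhalf negb (at_gen f) (at_gen (reduced g)).
Proof.
move=> ws; have -> : at_gen (succ f g) ws =
    at_gen (half_form negb (reduced f) (reduced g)) ws + f 1 * at_gen (reduced g) ws.
  have E : succ0 (reduced f) (reduced g) (hgen ws) =
      half_form negb (reduced f) (reduced g) (hgen ws).
    by rewrite /succ0 /= /Delta_succ linearB /= tensor_form_tens reduced1 mul0r subr0.
  exact: (congr1 (fun z => z + f 1 * at_gen (reduced g) ws) E).
rewrite half_form_gen /fhalf.
rewrite [RHS](eq_bigr _ (fun p _ => congr1 (fun z => z * _) (gen_reduced f p.1))).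
under [RHS]eq_bigr => p _ do rewrite mulrDl -mulrA.
rewrite big_split -mulr_sumr; congr (_ + _ * _).
have := fhalf1l negb (at_gen (reduced g)) ws; rewrite /fhalf => ->.
by rewrite reduced_gen -mulrnA mulnb andbb.
Qed.

(** * Fixed-point equations for linear forms *)

Section FixpointForm.
Variable l : {linear Hbar V -> Hbar V}.
Hypothesis nil_l : forall x, exists N, iter N l x = 0.
Variable e : lform V.

Let order x := projT1 (cid (nil_l x)).
Let sum N x : k^o := \sum_(i < N) e (iter i l x).

Lemma iter_linear i : linear (iter i l).
Proof. by elim: i => // i IH c x y; rewrite !iterS IH linearP. Qed.

Let sum_stable N x : iter N l x = 0 -> forall M, (N <= M)%N -> sum M x = sum N x.
Proof.
move=> Nx M /subnK <-; elim: (M - N)%N => // j IH.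
rewrite addSn -IH /sum big_ord_recr /= iterD Nx.
have z : iter j l 0 = 0 by elim: j {IH} => //= j ->; rewrite linear0.
by rewrite z linear0 addr0.
Qed.

Let sum_order x N : (order x <= N)%N -> sum N x = sum (order x) x.
Proof. by apply: sum_stable; rewrite /order; case: (cid _). Qed.

(* The sum of the e \o l^i, finite at every point. *)
Definition fix_form x := sum (order x) x.

Lemma fix_form_linear : linear fix_form.
Proof.
move=> c x y; pose N := maxn (order (c *: x + y)) (maxn (order x) (order y)).
rewrite /fix_form -!(@sum_order _ N) ?leq_max ?leqnn ?orbT //.
rewrite /sum scaler_sumr -big_split; apply: eq_bigr => i _.
by rewrite iter_linear linearP.
Qed.

Lemma fix_formE x : fix_form x = e x + fix_form (l x).
Proof.
pose N := maxn (order x) (order (l x)).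
rewrite /fix_form -(@sum_order _ N.+1) -?(@sum_order (l x) N) ?leq_max ?leqnn ?orbT //.
  by rewrite /sum big_ord_recl; congr (_ + _); apply: eq_bigr => i _; rewrite -iterSr.
by rewrite leqW // leq_max leqnn.
Qed.

Lemma fixpoint_form : exists f : lform V, forall x, f x = e x + f (l x).
Proof.
pose F : {linear Hbar V -> k^o} :=
  HB.pack fix_form (GRing.isLinear.Build k (Hbar V) k^o _ fix_form fix_form_linear).
by exists F => x; apply: fix_formE.
Qed.
End FixpointForm.


Section Contraction.
Variable beta : lform V.

Lemma contract_respects : respects (@bilin_rel k (Hbar V) (Hbar V))
  (fun p : Hbar V * Hbar V => beta p.1 *: p.2).
Proof.
move=> c _ _ _ [[x1 [x2 [y [-> -> ->]]]]|[x [y1 [y2 [-> -> ->]]]]] /=.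
  by rewrite linearP scalerDl scalerA.
by rewrite scalerDr !scalerA mulrC.
Qed.

Definition contract : {linear Hbar2 V -> Hbar V} := plift contract_respects.

Lemma contract_tens x y : contract (tens x y) = beta x *: y.
Proof. exact: (plift_gen contract_respects (x, y)). Qed.

(** Turns the equation f = e + (beta ⊗ f) D into f = e + f l for the linear operator l = (beta ⊗ id)
    D, to which [fixpoint_form] applies. *)
Lemma tensor_form_contract (f : lform V) z : tensor_form beta f z = f (contract z).
Proof.
move: z; apply: Tbar2_ext; [exact: linearP | by move=> c x y; rewrite !linearP |].
by move=> x y; rewrite tensor_form_tens contract_tens linearZ.
Qed.

Variable D : {linear Hbar V -> Hbar2 V}.
Variable split : seq (neword V) -> seq (seq (neword V) * seq (neword V)).
Hypothesis D_gen : forall ws,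
  D (hgen ws) = \sum_(p <- split ws) tens (hgen p.1) (hgen p.2).
Hypothesis split_balanced : forall ws, all (balanced (weight ws)) (split ws).
Hypothesis beta1 : beta 1 = 0.

(** Since beta(1) = 0, only terms with a nonempty left part survive, and their right part has fewer
    letters. *)
Lemma contract_nil x : exists N, iter N (contract \o D) x = 0.
Proof.
pose l := contract \o D; pose Q x := exists N, iter N l x = 0.
have stay N M z : iter N l z = 0 -> iter (M + N) l z = 0.
  by rewrite iterD => ->; elim: M => //= M ->; rewrite /l /= !linear0.
have QP c u v : Q u -> Q v -> Q (c *: u + v).
  move=> [N Nu] [M Mv]; exists (M + N)%N.
  by rewrite iter_linear stay // addnC stay // scaler0 addr0.
have Q0 : Q 0 by exists 0%N.
suff Qgen ws : Q (hgen ws) by move: x; apply: Hbar_ind => // c ws x; apply: QP.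
have [n] := ubnP (weight ws); elim: n ws => // n IH ws le_ws.
suff [N Nl] : Q (l (hgen ws)) by exists N.+1; rewrite iterSr.
rewrite /l /= D_gen linear_sum /=.
elim: (split ws) (split_balanced ws) => [|p r IHr] /=.
  by rewrite big_nil.
case/andP=> /eqP bal /IHr Qr; rewrite big_cons contract_tens.
case: p bal => -[|u L] M bal; first by rewrite hgen0 beta1 scale0r add0r.
apply: QP => //.
apply: IH; rewrite -ltnS (leq_trans _ le_ws) // ltnS -bal.
by rewrite -(add1n (weight M)) leq_add2r.
Qed.

Lemma solve_form (e : lform V) : exists f : lform V, forall ws,
  at_gen f ws = at_gen e ws + \sum_(p <- split ws) at_gen beta p.1 * at_gen f p.2.
Proof.
have [f fE] := fixpoint_form contract_nil e.
exists f => ws; rewrite {1}/at_gen fE /= -tensor_form_contract D_gen linear_sum /=.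
by congr (_ + _); apply: eq_bigr => p _; rewrite tensor_form_tens.
Qed.

End Contraction.

(** * Convolution inverses and the two logarithms *)

Lemma conv_right_inv (g : lform V) : g 1 = 1 ->
  exists2 h : lform V, h 1 = 1 & fconv (at_gen g) (at_gen h) =1 @funit V k.
Proof.
move=> g1; have beta1 : form_sub (eps V) g 1 = 0.
  by rewrite /= g1 -hgen0 -[eps V _]/(at_gen _ [::]) eps_gen subrr.
(* The equation h = e + (e - g) * h amounts to g * h = e. *)
have [h hE] := solve_form Delta_hgen (@bsplit_balanced V) beta1 (eps V).
have gh : fconv (at_gen g) (at_gen h) =1 @funit V k.
  move=> ws; have := hE ws.
  under eq_bigr => p _ do rewrite /at_gen /= -!/(at_gen _ _) eps_gen mulrBl.
  rewrite sumrB -!/(fconv _ _ _) fconv1l eps_gen addrCA -[X in X = _]addr0.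
  by move=> /addrI/esym/subr0_eq.
exists h => //; have := gh [::]; rewrite /fconv big_seq1 /= /at_gen hgen0 g1 mul1r.
by move=> ->.
Qed.

Lemma conv_inv_gen (g : lform V) : g 1 = 1 ->
  fconv (at_gen g) (at_gen (conv_inv g)) =1 @funit V k /\
  fconv (at_gen (conv_inv g)) (at_gen g) =1 @funit V k.
Proof.
move=> g1; have [h h1 gh] := conv_right_inv g1; have [g' _ hg'] := conv_right_inv h1.
(* The right inverse [h] of [g] has itself a right inverse [g']; then [g'] agrees with [g], and [h]
   is two-sided. *)
have hg : fconv (at_gen h) (at_gen g) =1 @funit V k.
  by move=> ws; rewrite -(hg' ws); apply: eq_fconv => //; apply: fconv_inv_uniq gh hg'.
have [gi ig] : conv g (conv_inv g) =1 eps V /\ conv (conv_inv g) g =1 eps V.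
  apply: (@pick_orP _ _ (fun h => conv g h =1 eps V /\ conv h g =1 eps V)); exists h.
  by split; apply: lform_ext => ws; rewrite -!/(at_gen _ ws) conv_gen ?gh ?hg eps_gen.
by split=> ws; rewrite -conv_gen /at_gen ?gi ?ig -/(at_gen _ _) eps_gen.
Qed.

Lemma at_gen1 (f : lform V) : at_gen f [::] = f 1.
Proof. by rewrite /at_gen hgen0. Qed.

Lemma reduced_id (f : lform V) : f 1 = 0 -> at_gen (reduced f) =1 at_gen f.
Proof. by move=> f1 ws; rewrite [RHS]gen_reduced f1 mul0r addr0. Qed.

Lemma Eprec_gen (alpha : lform V) : alpha 1 = 0 ->
  forall ws, at_gen (Eprec alpha) ws =
             funit k ws + fhalf id (at_gen alpha) (at_gen (Eprec alpha)) ws.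
Proof.
move=> alpha1; have [Psi PsiE] :=
  solve_form (half_hgen id) (@hsplit_balanced V id) alpha1 (eps V).
have E : Eprec alpha =1 form_add (eps V) (prec alpha (Eprec alpha)).
  apply: (@pick_orP (lform V) (eps V)
    (fun Phi : lform V => Phi =1 form_add (eps V) (prec alpha Phi))); exists Psi.
  apply: lform_ext => ws; rewrite -[LHS]/(at_gen _ ws) PsiE.
  rewrite -[RHS]/(at_gen (eps V) ws + at_gen (prec alpha Psi) ws) prec_gen; congr (_ + _).
  by apply: eq_bigr => p _; rewrite reduced_id.
move=> ws; rewrite {1}/at_gen E.
rewrite -[LHS]/(at_gen (eps V) ws + at_gen (prec alpha (Eprec alpha)) ws).
rewrite eps_gen prec_gen; congr (_ + _).
by apply: eq_bigr => p _; rewrite reduced_id.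
Qed.

Lemma sub_eps1 (Phi : lform V) : Phi 1 = 1 -> form_sub Phi (eps V) 1 = 0.
Proof. by move=> Phi1; rewrite /= Phi1 -hgen0 -/(at_gen _ _) eps_gen subrr. Qed.

Lemma sub_eps_gen (Phi : lform V) ws :
  at_gen (form_sub Phi (eps V)) ws = at_gen Phi ws - funit k ws.
Proof. by rewrite -eps_gen. Qed.

Lemma logprec_gen (Phi : lform V) : Phi 1 = 1 ->
  at_gen (logprec Phi) =1
  fhalf id (at_gen (form_sub Phi (eps V))) (at_gen (conv_inv Phi)).
Proof.
move=> Phi1 ws; rewrite prec_gen; apply: eq_fhalf => //.
exact/reduced_id/sub_eps1.
Qed.

Lemma logsucc_gen (Phi : lform V) : Phi 1 = 1 ->
  at_gen (logsucc Phi) =1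
  fhalf negb (at_gen (conv_inv Phi)) (at_gen (form_sub Phi (eps V))).
Proof.
move=> Phi1 ws; rewrite succ_gen; apply: eq_fhalf => //.
exact/reduced_id/sub_eps1.
Qed.

(** ((Phi - e) ≺ Phi^-1) ≺ Phi = (Phi - e) ≺ e = Phi - e, again by half-associativity. On single
    words this is the moment-cumulant formula. *)
Lemma logprecK (Phi : lform V) : Phi 1 = 1 -> forall ws,
  at_gen Phi ws - funit k ws = fhalf id (at_gen (logprec Phi)) (at_gen Phi) ws.
Proof.
move=> Phi1 ws; have [_ iPhi] := conv_inv_gen Phi1.
rewrite (eq_fhalf _ (logprec_gen Phi1) (frefl _)) fhalfA.
rewrite (eq_fhalf _ (frefl _) iPhi) fhalf1r sub_eps_gen.
by case: ws => // ; rewrite at_gen1 Phi1 /funit subrr.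
Qed.

Lemma logprec_Eprec (alpha : lform V) : alpha 1 = 0 ->
  logprec (Eprec alpha) =1 alpha.
Proof.
move=> alpha1; have E := Eprec_gen alpha1.
have Psi1 : Eprec alpha 1 = 1 by rewrite -at_gen1 E /fhalf big_nil addr0.
have [Psii _] := conv_inv_gen Psi1.
apply: lform_ext => ws; rewrite -!/(at_gen _ ws) logprec_gen //.
have S : at_gen (form_sub (Eprec alpha) (eps V)) =1
         fhalf id (at_gen alpha) (at_gen (Eprec alpha)).
  by move=> us; rewrite sub_eps_gen E addrC addKr.
rewrite (eq_fhalf _ S (frefl _)) fhalfA (eq_fhalf _ (frefl _) Psii) fhalf1r /=.
by case: ws => //; rewrite at_gen1 alpha1.
Qed.

Lemma logsucc1 (Phi : lform V) : logsucc Phi 1 = 0.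
Proof. by rewrite -at_gen1 succ_gen /fhalf big_nil. Qed.

End Generators.

(** Pulled back to words over [T], the two inverses are inverse to the same function, so they agree
    by uniqueness; log^≻ is then the same half-product on both sides. *)
Lemma logsucc_natural (k : fieldType) (V V' : lmodType k) (T : Type)
    (f : T -> V) (f' : T -> V') (Phi : lform V) (Phi' : lform V') :
  Phi 1 = 1 -> Phi' 1 = 1 ->
  (forall us, at_gen Phi (map (nemap f) us) = at_gen Phi' (map (nemap f') us)) ->
  forall us, at_gen (logsucc Phi) (map (nemap f) us) =
             at_gen (logsucc Phi') (map (nemap f') us).
Proof.
move=> Phi1 Phi1' E.
have [Pi _] := conv_inv_gen Phi1; have [_ iP'] := conv_inv_gen Phi1'.
have inv us : at_gen (conv_inv Phi) (map (nemap f) us) =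
              at_gen (conv_inv Phi') (map (nemap f') us).
  apply/esym; move: us.
  apply: (@fconv_inv_uniq _ _ (at_gen Phi \o map (nemap f))
    (at_gen (conv_inv Phi') \o map (nemap f'))
    (at_gen (conv_inv Phi) \o map (nemap f))) => us.
    by rewrite (eq_fconv (frefl _) E) -(fconv_map f') /= iP' -(funit_map f').
  by rewrite -(fconv_map f) /= Pi -(funit_map f).
move=> us; rewrite !logsucc_gen //.
rewrite -[LHS]/((fhalf _ _ _ \o _) us) -[RHS]/((fhalf _ _ _ \o _) us) !fhalf_map.
apply: eq_fhalf => // vs; rewrite -[LHS]/(at_gen _ _) -[RHS]/(at_gen _ _) !sub_eps_gen E.
by congr (_ - _); case: vs.
Qed.

(** * Characters and series *)

Section CharacterGen.
Variables (k : fieldType) (A : algType k) (phi : {linear A -> k^o}).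

Lemma character_gen ws :
  at_gen (character phi) ws = \prod_(w <- ws) phi (\prod_(a <- letters w) a).
Proof.
rewrite /at_gen [LHS]plift_gen /phi_prod big_map; apply: eq_bigr => w _.
exact: (plift_gen (phi_word_respects phi) w).
Qed.

Lemma character1 : character phi 1 = 1.
Proof. by rewrite -at_gen1 character_gen big_nil. Qed.

End CharacterGen.

(** * Forms on noncommutative polynomials *)

Section Polynomials.
Variables (k : fieldType) (n : nat).

Lemma ncX_prod (w : seq 'I_n) : \prod_(i <- w) ncX k i = << FMonom w >> :> ncpoly k n.
Proof.
elim: w => [|i w IH]; first by rewrite big_nil -(fmoneE 'I_n).
rewrite big_cons IH; apply: (etrans (malgM_def _ _)).
by rewrite fgmulUU mulr1 /ncX fmuE; congr mkmalgU; apply: fmmulE.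
Qed.

Lemma nceval_prod (A : algType k) (a : 'I_n -> A) (w : seq 'I_n) :
  nceval a (\prod_(i <- w) ncX k i) = \prod_(i <- w) a i.
Proof. by rewrite ncX_prod; apply: free_extU. Qed.

Lemma hword_gen (V : lmodType k) (b : 'I_n -> V) i w :
  hword [seq b j | j <- i :: w] = hgen (map (nemap b) [:: (i, w)]).
Proof. by []. Qed.

Lemma character_moment_gen (A : algType k) (phi : {linear A -> k^o}) (a : 'I_n -> A) us :
  at_gen (character (moment phi a)) (map (nemap (@ncX k n)) us) =
  at_gen (character phi) (map (nemap a) us).
Proof.
rewrite !character_gen !big_map; apply: eq_bigr => -[i s] _.
rewrite /letters /= -!map_cons !big_map.
by rewrite /moment /= nceval_prod.
Qed.

Lemma BPform_exists (nu : {linear ncpoly k n -> k^o}) :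
  exists nu' : {linear ncpoly k n -> k^o}, nu' 1 = 1 /\ Rform nu' = etaform nu.
Proof.
pose kappa us := at_gen (logsucc (character nu)) (map (nemap (@ncX k n)) us).
have [N NE] := moment_exists kappa.
pose nu' : {linear ncpoly k n -> k^o} :=
  free_ext (fun m : {fmonom 'I_n} =>
    (if fmonom_val m is i :: s then N (i, s) else 1) : k^o).
have nu'E w : nu' (\prod_(i <- w) ncX k i) = if w is i :: s then N (i, s) else 1.
  by rewrite ncX_prod; apply: free_extU.
exists nu'; split; first by have := nu'E [::]; rewrite big_nil.
pose Psi := character nu'.
have PsiE us : at_gen Psi (map (nemap (@ncX k n)) us) = \prod_(u <- us) N u.
  rewrite character_gen big_map; apply: eq_bigr => -[i s] _.
  by rewrite /letters /= -map_cons big_map nu'E.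
pose K us := at_gen (logprec Psi) (map (nemap (@ncX k n)) us).
have KE w : fhalf id K (fun us => \prod_(u <- us) N u) [:: w] = N w.
  have := logprecK (character1 nu') (map (nemap (@ncX k n)) [:: w]).
  rewrite PsiE big_seq1 /funit subr0 => ->.
  rewrite -[RHS]/((fhalf _ _ _ \o _) [:: w]) fhalf_map.
  by apply: eq_fhalf => // us; rewrite -PsiE.
(* [K] and [kappa] both produce the moments [N] from the same recursion, so their difference solves
   the homogeneous triangular system. *)
have Kkappa w : K [:: w] - kappa [:: w] = 0.
  apply: (@hsplit_triangular _ _ (fun us => K us - kappa us)
    (fun us => \prod_(u <- us) N u)).
    by rewrite big_nil.
  move=> u; rewrite /fhalf; under eq_bigr => p _ do rewrite mulrBl.
  by rewrite sumrB -NE; apply/eqP; rewrite subr_eq0; apply/eqP/KE.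
apply/funext => -[|i w] //.
rewrite /Rform /etaform /Rseries /etaseries /word_series !hword_gen.
exact/subr0_eq/Kkappa.
Qed.

End Polynomials.

Theorem proposition40 (k : fieldType) (char0 : [pchar k] =i pred0)
    (A : algType k) (phi : {linear A -> k^o}) (phi1 : phi 1 = 1)
    (n : nat) (a : 'I_n -> A) :
  (forall w : seq 'I_n, w != [::] ->
     logprec (BPchar (character phi)) (hword [seq a i | i <- w])
     = logsucc (character phi) (hword [seq a i | i <- w])) /\
  [/\ Rform (BPform (moment phi a)) = Rseries (BPchar (character phi)) a,
      Rseries (BPchar (character phi)) a = etaseries (character phi) a
    & etaseries (character phi) a = etaform (moment phi a)].
Proof.
have logE : logprec (BPchar (character phi)) =1 logsucc (character phi).
  by apply: logprec_Eprec; apply: logsucc1.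
have eta : etaseries (character phi) a = etaform (moment phi a).
  apply/funext => -[|i w] //.
  rewrite /etaform /etaseries /word_series !hword_gen.
  apply/esym; apply: (@logsucc_natural _ _ _ _ _ _
    (character (moment phi a)) (character phi)).
  - exact: character1.
  - exact: character1.
  - exact: character_moment_gen.
have R_eta : Rseries (BPchar (character phi)) a = etaseries (character phi) a.
  by apply/funext => -[|i w] //; apply: logE.
(* By [BPform_exists] the choice in [BPform] satisfies its defining relation. *)
have [_ BP] : BPform (moment phi a) 1 = 1 /\
    Rform (BPform (moment phi a)) = etaform (moment phi a).
  exact: (@pick_orP {linear ncpoly k n -> k^o} (moment phi a)
    (fun nu' => nu' 1 = 1 /\ Rform nu' = etaform (moment phi a)) (BPform_exists _)).
by split=> [w _|]; [exact: logE | rewrite BP R_eta eta].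
Qed.
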